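(* For every $s\ge1$, $$P_N(\{n\in\Omega_N: p^-(n)\ge n^{\frac1s}\})=P_N\Big(\frac{\log n}{\log p^-(n)}\le s\Big)\sim (e^{-\gamma}\log\log N)\,\frac{s\,\omega(s)}{\log N},\qquad\text{as } N\to\infty.$$
   Context: $\{p_j\}_{j=1}^\infty$ denotes the primes in increasing order. $p^-(n)$ denotes the smallest prime divisor of $n$, with the conventions $p^-(1)=1$ and $\frac{\log n}{\log p^-(n)}\big|_{n=1}=0$. $\Omega_N=\{n\in\mathbb{N}: p_j\nmid n \text{ for all } j>N\}$, $C_N=\sum_{n\in\Omega_N}\frac1n<\infty$, and $P_N$ is the probability measure on $\Omega_N$ given by $P_N(\{n\})=\frac1{C_N}\frac1n$, $n\in\Omega_N$. $\gamma$ is Euler's constant. The Buchstab function $\omega$, defined on $[1,\infty)$, is the unique continuous function satisfying $\omega(s)=\frac1s$ for $1\le s\le2$ and $(s\omega(s))'=\omega(s-1)$ for $s>2$. The notation $f(N)\sim g(N)$ means $f(N)/g(N)\to1$. *)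

(* Defs.v *)
From HB Require Import structures.
From mathcomp Require Import all_boot all_order all_algebra.
From mathcomp Require Import all_classical all_reals all_analysis.
From mathcomp Require Import ring lra.
Import Order.TTheory GRing.Theory Num.Theory.
Import numFieldNormedType.Exports.

Set Implicit Arguments.
Unset Strict Implicit.
Unset Printing Implicit Defensive.

Local Open Scope classical_set_scope.
Local Open Scope ring_scope.

(* [nth_prime j] is p_j for j >= 1: p_1 = 2, p_2 = 3, p_3 = 5 and so on; the
   value at j = 0 is junk, only used to start the recursion. *)
Lemma next_prime_subproof (m : nat) : exists p, (m < p)%N && prime p.
Proof. by have [p mp pp] := prime_above m; exists p; rewrite mp. Qed.

Definition next_prime (m : nat) : nat := ex_minn (next_prime_subproof m).

Definition nth_prime (j : nat) : nat := iter j next_prime 0%N.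

Lemma nth_primeS_prime (j : nat) : prime (nth_prime j.+1).
Proof. by rewrite /nth_prime iterS /next_prime; case: ex_minnP => p /andP[]. Qed.

Lemma nth_prime_lt (j : nat) : (nth_prime j < nth_prime j.+1)%N.
Proof.
by rewrite {2}/nth_prime iterS /next_prime; case: ex_minnP => p /andP[].
Qed.

Lemma nth_prime_surj (q : nat) : prime q -> exists2 j, (0 < j)%N & nth_prime j = q.
Proof.
move=> pq.
have ge_id j : (j <= nth_prime j)%N.
  by elim: j => // j IH; exact: leq_ltn_trans IH (nth_prime_lt j).
have [j qj jmin] := @ex_minnP (fun j => (q <= nth_prime j)%N) (ex_intro _ q (ge_id q)).
case: j qj jmin => [|j] qj jmin.
  by move: qj; rewrite leqn0 => /eqP q0; rewrite q0 in pq.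
have jq : (nth_prime j < q)%N.
  by rewrite ltnNge; apply/negP => /jmin; rewrite ltnn.
exists j.+1 => //; apply/eqP; rewrite eqn_leq qj andbT.
rewrite /nth_prime iterS /next_prime; case: ex_minnP => p _ pmin.
by apply: pmin; rewrite jq.
Qed.

(* The set Omega_N, seen inside the type nat, which contains 0. *)
Definition Omega (N : nat) : set nat :=
  [set n | (0 < n)%N /\ forall j, (N < j)%N -> ~~ (nth_prime j %| n)%N].

Lemma Omega1 (N : nat) : Omega N 1%N.
Proof.
split=> // -[//|j] _; rewrite dvdn1; apply/eqP => p1.
by have := nth_primeS_prime j; rewrite p1.
Qed.

Section harmonic_probability.
Variable R : realType.

Let h (n : nat) : \bar R := (n%:R^-1)%:E.

Let h_ge0 n : (0 <= h n)%E.
Proof. by rewrite lee_fin invr_ge0. Qed.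

Definition C (N : nat) : R := fine (\esum_(n in Omega N) (n%:R^-1)%:E).

Lemma sum_Omega_le (N M : nat) :
  \sum_(i < M | nat_of_ord i \in Omega N) (i%:R^-1 : R) <= 2 ^+ N.
Proof.
elim: N => [|N IH].
  rewrite expr0; have O1 n : Omega 0 n -> n = 1%N.
    move=> [n0 nO]; apply/eqP/negPn/negP => n1.
    have n2 : (1 < n)%N by rewrite ltn_neqAle eq_sym n1.
    have [j j0 jq] := nth_prime_surj (pdiv_prime n2).
    by have := nO j j0; rewrite jq pdiv_dvd.
  case: M => [|[|M]].
  - by rewrite big_ord0.
  - by rewrite big1// => i _; rewrite ord1 invr0.
  - rewrite (bigD1 (inord 1)) /=; last by rewrite inE inordK//; exact: Omega1.
    rewrite inordK// invr1 big1 ?addr0// => i /andP[].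
    by rewrite inE => /O1 i1 /eqP[]; apply/val_inj; rewrite /= inordK.
set p := nth_prime N.+1.
have p2 : (1 < p)%N by rewrite prime_gt1// nth_primeS_prime.
set S := (X in X <= _).
have S_ge0 : 0 <= S by apply: sumr_ge0 => i _; rewrite invr_ge0.
suff : S <= 2 ^+ N + S / 2 by rewrite exprS; lra.
rewrite {1}/S (bigID (fun i : 'I_M => (p %| i)%N)) /= addrC lerD//.
  apply: le_trans IH; rewrite [leRHS]big_mkcond [leLHS]big_mkcond /=.
  apply: ler_sum => i _; case: ifPn => [/andP[]|_]; last by case: ifP.
  rewrite !inE => -[i0 iO] pi; rewrite ifT// inE; split=> // j.
  by rewrite leq_eqVlt => /predU1P[<-//|]; exact: iO.
have pR : p%:R^-1 <= 2^-1 :> R by rewrite lef_pV2 ?posrE ?ltr0n ?ler_nat// (ltn_trans _ p2).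
apply: (@le_trans _ _ (S * p%:R^-1)); last by rewrite ler_wpM2l.
pose G (m : nat) : R := (p%:R * m%:R)^-1.
apply: (@le_trans _ _ (\sum_(i < M | (nat_of_ord i \in Omega N.+1) && (p %| i)%N)
   \sum_(m < M | (nat_of_ord m \in Omega N.+1) && (nat_of_ord i == p * m)%N) G m)).
  apply: ler_sum => i /andP[]; rewrite inE => -[i0 iO] /dvdnP[m im].
  have m0 : (0 < m)%N by case: m im i0 => // ->.
  have mM : (m < M)%N by rewrite (ltn_trans _ (ltn_ord i))// im ltn_Pmulr.
  rewrite (bigD1 (Ordinal mM)) /=; last first.
    rewrite mulnC im eqxx andbT inE; split=> // j Nj.
    by apply: contra (iO j Nj); rewrite im => /dvdn_mulr.
  have -> : i%:R^-1 = G m by rewrite /G im natrM mulrC.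
  rewrite lerDl sumr_ge0// => *.
  by rewrite invr_ge0 mulr_ge0.
rewrite (exchange_big_dep (fun m : 'I_M => nat_of_ord m \in Omega N.+1)) /=; last first.
  by move=> i j _ /andP[].
rewrite /S mulr_suml; apply: ler_sum => m mO.
have Gm : 0 <= G m by rewrite invr_ge0 mulr_ge0.
have [pmM|pmM] := ltnP (p * m) M; last first.
  rewrite big1; first by rewrite mulr_ge0 ?invr_ge0.
  move=> i /andP[_ /andP[_ /eqP ipm]].
  by have := ltn_ord i; rewrite ltnNge ipm pmM.
rewrite big_mkcond (bigD1 (Ordinal pmM)) //= big1 ?addr0; last first.
  move=> i /eqP ni; case: ifPn => // /andP[_ /andP[_ /eqP ipm]].
  by exfalso; apply: ni; exact/val_inj.
have -> : m%:R^-1 / p%:R = G m by rewrite /G invfM mulrC.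
by case: ifP.
Qed.

Lemma C_EFin (N : nat) : (\esum_(n in Omega N) h n)%E = (C N)%:E.
Proof.
suff le : (\esum_(n in Omega N) h n <= (2 ^+ N)%:E)%E.
  rewrite /C fineK// ge0_fin_numE ?esum_ge0//.
  by rewrite (le_lt_trans le) ?ltry.
rewrite -(set_mem_set (Omega N)) -nneseries_esum//.
apply: lime_le; first exact: is_cvg_nneseries.
apply: nearW => M; rewrite sumEFin lee_fin big_mkord.
exact: sum_Omega_le.
Qed.

Lemma C_gt0 (N : nat) : 0 < C N.
Proof.
rewrite -lte_fin -C_EFin (@lt_le_trans _ _ (h 1))//.
  by rewrite /h invr1 lte_fin.
apply: esum_ge; exists [set 1%N]; last by rewrite fsbig_set1.
by split=> // _ ->; exact: Omega1.
Qed.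

(* The measure P_N, extended to the subsets of nat by giving mass 0 to the
   complement of Omega N. *)
Definition P (N : nat) (A : set nat) : \bar R :=
  \esum_(n in A `&` Omega N) ((C N)^-1 * n%:R^-1)%:E.

Let w_ge0 N (n : nat) : (0 <= ((C N)^-1 * n%:R^-1)%:E)%E.
Proof. by rewrite lee_fin mulr_ge0 ?invr_ge0 // ltW ?C_gt0. Qed.

Let P0 N : P N set0 = 0%E.
Proof. by rewrite /P set0I esum_set0. Qed.

Let P_ge0 N A : (0 <= P N A)%E.
Proof. exact: esum_ge0. Qed.

Let P_sigma_additive N : semi_sigma_additive (P N).
Proof.
move=> F _ tF _; rewrite /P setI_bigcupl nneseries_sum_bigcup//; last first.
  exact: trivIset_setIr.
by apply: is_cvg_nneseries => n _ _; exact: P_ge0.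
Qed.

HB.instance Definition _ (N : nat) :=
  isMeasure.Build _ nat R (P N) (P0 N) (@P_ge0 N) (@P_sigma_additive N).

Let P_setT N : P N setT = 1%E.
Proof.
rewrite /P setTI -(set_mem_set (Omega N)) -nneseries_esum//.
under eq_eseriesr do rewrite EFinM.
rewrite nneseriesZl// nneseries_esum// set_mem_set C_EFin -EFinM mulVf//.
by rewrite gt_eqF ?C_gt0.
Qed.

HB.instance Definition _ (N : nat) :=
  Measure_isProbability.Build _ nat R (P N) (P_setT N).

Lemma P_set1 (N n : nat) : Omega N n -> P N [set n] = ((C N)^-1 * n%:R^-1)%:E.
Proof. by move=> On; rewrite /P setIidl ?esum_set1// => _ ->. Qed.

End harmonic_probability.
Arguments C {R} N.
Arguments P {R} N A.

(* At n = 1, where [pdiv 1 = 1], this is 0 / 0 = 0. *)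
Definition log_ratio (R : realType) (n : nat) : R := ln n%:R / ln (pdiv n)%:R.

Lemma log_ratio1 (R : realType) : log_ratio R 1 = 0.
Proof. by rewrite /log_ratio ln1 mul0r. Qed.

(* f(N) / g(N) tends to 1; the finitely many N with g(N) = 0 are harmless. *)
Definition asymp_equiv (R : realType) (f g : nat -> R) : Prop :=
  f N / g N @[N --> \oo] --> (1 : R).

Section euler_constant.
Variable R : realType.

Let u (n : nat) : R := \sum_(1 <= k < n.+1) k%:R^-1 - ln n%:R.

Definition euler_gamma : R := limn u.

Lemma is_cvg_euler_gamma : cvgn u.
Proof.
have lnS (n : nat) : (0 < n)%N -> ln n.+1%:R - ln n%:R <= n%:R^-1 :> R.
  move=> n0; have n0' : 0 < n%:R :> R by rewrite ltr0n.
  rewrite -ln_div ?posrE ?ltr0n//.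
  rewrite (_ : _ / _ = 1 + n%:R^-1); last first.
    by rewrite -natr1 mulrDl divff ?gt_eqF// mul1r.
  by rewrite le_ln1Dx// (lt_le_trans (_ : -1 < 0))// ?invr_ge0 ?ltW.
have u_ge0 (n : nat) : ln n.+1%:R <= \sum_(1 <= k < n.+1) k%:R^-1 :> R.
  elim: n => [|n IH]; first by rewrite ln1 big_geq.
  rewrite big_nat_recr//= addrC.
  by apply: le_trans (lerD (lnS n.+1 isT) IH); rewrite subrK.
suff /cvg_ex[l ul] : cvgn (fun n => u n.+1).
  by apply/cvg_ex; exists l; rewrite -cvg_shiftS.
apply: nonincreasing_is_cvgn.
  apply/nonincreasing_seqP => n; rewrite /u [X in X - _ <= _]big_nat_recr//=.
  set S := \sum_(_ <= _ < _) _.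
  have n0 : 0 < n.+2%:R :> R by rewrite ltr0n.
  suff : ln n.+1%:R - ln n.+2%:R <= - n.+2%:R^-1 :> R.
    by move: (ln _) (ln _) S (n.+2%:R^-1) => a b S c; lra.
  rewrite -ln_div ?posrE ?ltr0n//.
  rewrite (_ : _ / _ = 1 + - n.+2%:R^-1); last first.
    have -> : n.+1%:R = n.+2%:R - 1 :> R by rewrite -(natr1 n.+1) addrK.
    by rewrite mulrBl divff ?gt_eqF// mul1r.
  by rewrite le_ln1Dx// ltrN2 invf_lt1 ?ltr1n.
exists 0 => _ [n _ <-]; rewrite /u subr_ge0.
rewrite (le_trans (u_ge0 n))// [leRHS]big_nat_recr//= lerDl.
by rewrite invr_ge0.
Qed.

End euler_constant.

(* Only the values of [w] on [1, +oo[ are constrained (they are determined). *)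
Definition is_buchstab (R : realType) (w : R -> R) : Prop :=
  [/\ {within `[1, +oo[, continuous w},
      forall s : R, 1 <= s <= 2 -> w s = s^-1 &
      forall s : R, 2 < s -> is_derive s 1 (fun t : R => t * w t) (w (s - 1))].

Section buchstab_exists.
Variable R : realType.
Let mu := @lebesgue_measure R.

Let G (w : R -> R) (x : R) : R :=
  (\int[mu]_(t in `[0, x]) w t)%R - (\int[mu]_(t in `[0, 1]) w t)%R.

Let T (w : R -> R) (s : R) : R :=
  (1 + G w (Num.max 1 (s - 1))) / Num.max 1 s.

Let W (n : nat) : R -> R := iter n T (fun s => (Num.max 1 s)^-1).

Let continuous_max1 (c : R) : continuous (fun s : R => Num.max 1 (s - c)).
Proof.
move=> s; apply: (@continuous_max _ _ (cst 1) (fun s : R => s - c)).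
  exact: cvg_cst.
by apply: cvgB; [exact: cvg_id|exact: cvg_cst].
Qed.

Let continuous_inv_max1 : continuous (fun s : R => (Num.max 1 s)^-1).
Proof.
move=> s; apply: cvgV; first by rewrite gt_eqF// lt_max ltr01.
by apply: (@continuous_max _ _ (cst 1) id); [exact: cvg_cst|exact: cvg_id].
Qed.

Let G_derive (w : R -> R) (x : R) : continuous w -> 0 < x ->
  is_derive x 1 (G w) (w x).
Proof.
move=> cw x0.
have iw : mu.-integrable `[0, x + 1] (EFin \o w).
  apply: continuous_compact_integrable; first exact: segment_compact.
  exact: continuous_subspaceT.
have [d1 d2] := continuous_FTC1_closed (ltr_pwDr ltr01 (lexx x)) iw x0 (cw x).
rewrite -[X in is_derive _ _ _ X]subr0; apply: is_deriveB.
by apply: (DeriveDef d1); rewrite -derive1E; exact: d2.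
Qed.

Let T_continuous (w : R -> R) : continuous w -> continuous (T w).
Proof.
move=> cw s; apply: cvgM; last exact: continuous_inv_max1.
apply: cvgD; first exact: cvg_cst.
apply: (@continuous_comp _ _ _ (fun s : R => Num.max 1 (s - 1)) (G w)).
  exact: continuous_max1.
have m0 : 0 < Num.max 1 (s - 1) by rewrite lt_max ltr01.
apply: differentiable_continuous; apply/derivable1_diffP.
by have [] := G_derive cw m0.
Qed.

Let W_continuous n : continuous (W n).
Proof.
by elim: n => [|n IH]; [exact: continuous_inv_max1|exact: T_continuous].
Qed.

Let eq_T (w v : R -> R) (x s : R) : 1 <= x ->
  (forall t, t <= x -> w t = v t) -> s <= x + 1 -> T w s = T v s.
Proof.
move=> x1 wv sx; rewrite /T /G; congr ((1 + (_ - _)) / _);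
  apply: eq_Rintegral => t; rewrite inE/= in_itv/= => /andP[_ tx]; apply: wv.
  by rewrite (le_trans tx)// ge_max x1 lerBlDr.
exact: le_trans tx x1.
Qed.

Let W_le2 n s : s <= 2 -> W n s = (Num.max 1 s)^-1.
Proof.
case: n => [//|n] s2; rewrite /W iterS -/(W n) /T /G max_l; last by lra.
by rewrite subrr addr0 mul1r.
Qed.

Let W_stableS n s : s <= n%:R + 2 -> W n.+1 s = W n s.
Proof.
elim: n s => [|n IH] s sn; first by rewrite !W_le2//; lra.
rewrite /W !iterS -/(W n) -iterS -/(W n.+1).
apply: (@eq_T _ _ (n%:R + 2)) => //; last by move: sn; rewrite -natr1; lra.
by have : 0 <= n%:R :> R := ler0n _ _; lra.
Qed.

Let W_stable n m s : (n <= m)%N -> s <= n%:R + 2 -> W m s = W n s.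
Proof.
move=> + sn; elim: m => [|m IH]; first by rewrite leqn0 => /eqP ->.
rewrite leq_eqVlt => /predU1P[->//|nm]; rewrite W_stableS ?IH//.
by rewrite (le_trans sn)// lerD2r ler_nat.
Qed.

Let w (s : R) : R := W (Num.truncn s) s.

Let wE n s : s <= n%:R + 2 -> w s = W n s.
Proof.
move=> sn; have st : s <= (Num.truncn s)%:R + 2.
  have [s0|s0] := leP 0 s; last by rewrite (le_trans (ltW s0))// addr_ge0.
  by have /andP[_] := truncn_itv s0; rewrite -natr1; lra.
rewrite /w; have [nm|/ltnW mn] := leqP n (Num.truncn s); first exact: W_stable.
by rewrite (W_stable mn st).
Qed.

Let w_continuous : continuous w.
Proof.
move=> s; have [n sn] : exists n : nat, s < n%:R + 2.
  exists (Num.truncn `|s|).+1; rewrite (le_lt_trans (ler_norm s))//.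
  by have /andP[_] := truncn_itv (normr_ge0 s); lra.
rewrite /continuous_at (@wE n s (ltW sn)).
apply: (@cvg_trans _ (W n x @[x --> s])); last exact: W_continuous.
apply: near_eq_cvg; near=> x; rewrite (@wE n)//.
by apply: ltW; near: x; exact: lt_nbhsl.
Unshelve. all: by end_near. Qed.

Let w_fix s : w s = T w s.
Proof.
have [n sn] : exists n : nat, s < n%:R + 2.
  exists (Num.truncn `|s|).+1; rewrite (le_lt_trans (ler_norm s))//.
  by have /andP[_] := truncn_itv (normr_ge0 s); lra.
rewrite (@wE n.+1); last by rewrite -natr1; lra.
rewrite /W iterS -/(W n); apply: (@eq_T _ _ (n%:R + 2)); last by lra.
  by have : 0 <= n%:R :> R := ler0n _ _; lra.
by move=> t tn; rewrite (@wE n t tn).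
Qed.

Let near_eq_is_derive1 (f g : R -> R) (s l : R) :
  {near s, f =1 g} -> is_derive s 1 f l -> is_derive s 1 g l.
Proof. exact: near_eq_is_derive. Qed.

Let T_fix_derive (v : R -> R) (s : R) : continuous v -> v =1 T v -> 2 < s ->
  is_derive s 1 (fun t => t * v t) (v (s - 1)).
Proof.
move=> cv vT s2; apply: (@near_eq_is_derive1 (cst 1 + (G v \o (fun t => t - 1)))).
  near=> t; have t2 : 2 < t by near: t; exact: lt_nbhsr.
  have -> : v t = (1 + G v (t - 1)) / t.
    by rewrite vT /T [Num.max 1 (t - 1)]max_r ?[Num.max 1 t]max_r//; lra.
  rewrite -[LHS]/(1 + G v (t - 1)); move: (G v _) => g.
  by rewrite mulrC divfK//; lra.
have s1 : 0 < s - 1 by lra.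
have := G_derive cv s1.
move: (G v) (v _) => g l gl.
rewrite -[X in is_derive _ _ _ X]add0r; apply: is_deriveD.
rewrite -[X in is_derive _ _ _ X]mulr1; apply: is_derive1_comp.
by rewrite -[X in is_derive _ _ _ X]subr0; apply: is_deriveB.
Unshelve. all: by end_near. Qed.

Lemma buchstab_exists : exists w : R -> R, is_buchstab w.
Proof.
exists w; split.
- exact: continuous_subspaceT.
- by move=> s /andP[s1 s2]; rewrite (@wE 0) ?add0r// W_le2// max_r.
- by move=> s; exact: T_fix_derive.
Qed.

End buchstab_exists.

(* Main.v *)
Require Import Defs.
From mathcomp Require Import all_boot all_order all_algebra.
From mathcomp Require Import all_classical all_reals all_analysis.
From mathcomp Require Import ring lra zify.
Import Order.TTheory GRing.Theory Num.Theory.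
Import numFieldNormedType.Exports.

Set Implicit Arguments.
Unset Strict Implicit.
Unset Printing Implicit Defensive.

Local Open Scope classical_set_scope.
Local Open Scope ring_scope.

(** Put [q = nth_prime N]. The event is a statement about the multiples [p * m]
   of a prime [p], where [m <= p ^ (s - 1)] has no prime factor below [p]; so
   its probability is [1 / C N] times the sum over the primes [p <= q] of
   [1 / p] times

     [F (s - 1) p], the sum of the [1 / m] over the [p]-rough [m <= p ^ (s - 1)],

   up to the number 1 and to the condition that [p * m] be a product of primes
   at most [q], which is void when [p <= q ^ (1 / s)]. If [F u p] has a limit
   [g u] as [p] grows, then both the sum over [p <= q ^ (1 / s)] and the sum over
   [p <= q] are equivalent to [g (s - 1) * ln (ln q)], by Mertens' second theorem
   ([mertens2], [prime_sum_average]), since [ln (ln _)] does not tell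
   [q ^ (1 / s)] from [q]. On the other hand [C N] is the Euler product of the
   [1 / (1 - 1 / p)] over [p <= q] ([C_prime_sum]), and Mertens' third theorem
   ([mertens3]) makes it equivalent to [exp gamma * ln q]. Finally [ln q] is
   equivalent to [ln N] ([ln_nth_prime_ratio]).

   The limit [g u = (u + 1) * w (u + 1)] of [F u] is obtained in [rough_limit] by
   induction on the integer part of [u]. Sorting the rough numbers by their least
   prime factor, [F u y = 1 + sum of F (u / t - 1) p / p] over the primes
   [p = y ^ t] from [y] to [y ^ u] ([rough_sum_buchstab]), while the reciprocals
   of the primes between [y ^ a] and [y ^ b] add up to [ln b - ln a + o(1)]
   ([prime_recip_window]). Hence [g u = 1 + int_1^u g (u / t - 1) dt / t], which
   is the differential equation of [w] integrated. As [F] is monotone in [u],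
   pointwise convergence at the points of a geometric subdivision suffices to
   control the Riemann sums.

   Mertens' theorems are built from Chebyshev's bound. The first comes from
   Legendre's formula for [n!], the second from summation by parts. For the
   constant of the third, let [L n] be the logarithm of the Euler product over
   [p <= n]; the second theorem gives [L n = ln (ln n) + k + o(1)] for some [k].
   Weighting its terms by [p ^ (- d)] gives the logarithm of zeta(1 + d), hence
   [- ln d], up to [o(1)] as [d] tends to 0. The harmonic numbers
   [H n = ln n + gamma + o(1)], weighted by the powers of [r = 2 ^ (- d)], give
   [- ln (1 - r)], hence [- ln d - ln (ln 2)]. Applied to
   [L (2 ^ n) - H n], whose limit is [k + ln (ln 2) - gamma], Abel's theorem
   ([abel_theorem]) then yields [k = gamma]. *)

(** * Sums over primes *)

Definition prime_sum (R : realType) (f : nat -> R) (n : nat) : R :=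
  \sum_(0 <= p < n.+1 | prime p) f p.

Lemma prime_sum0 (R : realType) (f : nat -> R) : prime_sum f 0 = 0.
Proof. by rewrite /prime_sum big_mkcond big_nat1. Qed.

Lemma prime_sumS (R : realType) (f : nat -> R) n :
  prime_sum f n.+1 = prime_sum f n + (if prime n.+1 then f n.+1 else 0).
Proof. by rewrite /prime_sum !(big_mkcond prime) big_nat_recr. Qed.

Lemma prime_sum_split (R : realType) (f : nat -> R) m n : (m <= n)%N ->
  prime_sum f n = prime_sum f m + \sum_(m.+1 <= p < n.+1 | prime p) f p.
Proof. by move=> mn; rewrite /prime_sum (big_cat_nat (n := m.+1)). Qed.

Lemma ler_prime_sum (R : realType) (f g : nat -> R) n :
  (forall p, prime p -> (p <= n)%N -> f p <= g p) ->
  prime_sum f n <= prime_sum g n.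
Proof.
move=> fg; rewrite /prime_sum big_nat_cond [leRHS]big_nat_cond.
by apply: ler_sum => p /andP[/andP[_ pn] pp]; apply: fg.
Qed.

Lemma eq_prime_sum (R : realType) (f g : nat -> R) n :
  (forall p, prime p -> f p = g p) -> prime_sum f n = prime_sum g n.
Proof. by move=> fg; exact: eq_bigr. Qed.

Lemma prime_sum_ge0 (R : realType) (f : nat -> R) n :
  (forall p, prime p -> 0 <= f p) -> 0 <= prime_sum f n.
Proof. by move=> f0; exact: sumr_ge0. Qed.

Lemma prime_sum_homo (R : realType) (f : nat -> R) m n :
  (forall p, prime p -> 0 <= f p) -> (m <= n)%N ->
  prime_sum f m <= prime_sum f n.
Proof. by move=> f0 mn; rewrite (prime_sum_split _ mn) lerDl sumr_ge0. Qed.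

Lemma prime_sumD (R : realType) (f g : nat -> R) n :
  prime_sum (fun p => f p + g p) n = prime_sum f n + prime_sum g n.
Proof. exact: big_split. Qed.

Lemma prime_sumB (R : realType) (f g : nat -> R) n :
  prime_sum (fun p => f p - g p) n = prime_sum f n - prime_sum g n.
Proof. exact: sumrB. Qed.

Lemma prime_sumZ (R : realType) (c : R) (f : nat -> R) n :
  prime_sum (fun p => c * f p) n = c * prime_sum f n.
Proof. by rewrite /prime_sum mulr_sumr. Qed.

Lemma prime_sum_le_sum (R : realType) (f : nat -> R) n :
  (forall k, 0 <= f k) -> prime_sum f n <= \sum_(1 <= k < n.+1) f k.
Proof.
move=> f0; rewrite /prime_sum big_mkcond big_nat_recl//= add0r big_add1 /=.
by apply: ler_sum => k _; case: ifP.
Qed.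

(** * Elementary estimates *)

Lemma ln_natr_ge0 (R : realType) n : 0 <= ln n%:R :> R.
Proof. by case: n => [|n]; [rewrite ln0|rewrite ln_ge0// ler1n]. Qed.

Lemma ln_natr_gt0 (R : realType) n : (1 < n)%N -> 0 < ln n%:R :> R.
Proof. by move=> n1; rewrite ln_gt0// ltr1n. Qed.

Lemma ler_ln_natr (R : realType) m n : (m <= n)%N -> ln m%:R <= ln n%:R :> R.
Proof.
case: m => [|m] mn; first by rewrite ln0// ln_natr_ge0.
by rewrite ler_ln ?posrE ?ltr0n ?ler_nat// (leq_trans _ mn).
Qed.

Lemma ln_le_subr1 (R : realType) (x : R) : 0 < x -> ln x <= x - 1.
Proof.
by move=> x0; rewrite -{1}(subrK 1 x) addrC le_ln1Dx// ltrBrDl subrr.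
Qed.

Lemma ln_ge_1subV (R : realType) (x : R) : 0 < x -> 1 - x^-1 <= ln x.
Proof.
move=> x0; have := @ln_le_subr1 R x^-1; rewrite invr_gt0 lnV ?posrE// => /(_ x0).
lra.
Qed.

Lemma ln_natrS_subr (R : realType) n : (0 < n)%N ->
  ln n.+1%:R - ln n%:R <= n%:R^-1 :> R.
Proof.
move=> n0; have n0' : 0 < n%:R :> R by rewrite ltr0n.
rewrite -ln_div ?posrE ?ltr0n//.
apply: le_trans (ln_le_subr1 _) _; first by rewrite divr_gt0// ltr0n.
by rewrite -natr1 mulrDl divff ?gt_eqF// mul1r addrC addKr.
Qed.

Lemma ln2_le1 (R : realType) : ln 2 <= 1 :> R.
Proof. by have := @ln_le_subr1 R 2 ltac:(lra); lra. Qed.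

(** * Chebyshev's bound and Mertens' first theorem *)

Lemma prod_primes_dvdn m n x :
  (forall p, prime p -> (m <= p < n)%N -> (p %| x)%N) ->
  (\prod_(m <= p < n | prime p) p %| x)%N.
Proof.
have [nm|mn] := leqP n m; first by rewrite big_geq.
elim: n mn => // n IH; rewrite ltnS leq_eqVlt => /predU1P[->|mn] H.
  rewrite big_mkcond big_nat1; case: ifP => // pn.
  by rewrite H// leqnn ltnSn.
rewrite big_mkcond big_nat_recr ?(ltnW mn)//= -big_mkcond /=.
have IHx : (\prod_(m <= p < n | prime p) p %| x)%N.
  by apply: IH => // p pp /andP[mp pn]; rewrite H// mp ltnS ltnW.
case: ifP => pn; last by rewrite muln1.
rewrite Gauss_dvd ?IHx/=; first by rewrite H// ltnSn ltnW.
rewrite coprime_sym big_nat_cond.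
elim/big_ind: _ => [|a b|p /andP[/andP[_ np] pp]]; first exact: coprimen1.
- by rewrite coprimeMr => -> ->.
- by rewrite prime_coprime// dvdn_prime2// gtn_eqF.
Qed.

Lemma prime_gt_ndvd_fact p n : prime p -> (n < p)%N -> ~~ (p %| n`!)%N.
Proof.
move=> pp; elim: n => [|n IH] np; first by rewrite fact0 dvdn1 gtn_eqF ?prime_gt1.
rewrite factS Euclid_dvdM// negb_or IH ?(ltnW np)// andbT.
by rewrite gtnNdvd.
Qed.

Lemma bin_le_expn2 n m : ('C(n, m) <= 2 ^ n)%N.
Proof.
elim: n m => [|n IH] [|m]; rewrite ?bin0 ?expn_gt0//.
by rewrite binS expnS mul2n -addnn leq_add.
Qed.

(** The primes [p] such that [m < p <= 2m] all divide the central binomial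
   coefficient, which is at most [4 ^ m]. *)
Lemma prod_primes_double_le m :
  (\prod_(m.+1 <= p < (m + m).+1 | prime p) p <= 2 ^ (m + m))%N.
Proof.
apply: leq_trans (bin_le_expn2 _ m).
apply: dvdn_leq; first by rewrite bin_gt0 leq_addr.
apply: prod_primes_dvdn => p pp /andP[mp pm].
have : (p %| (m + m)`!)%N by rewrite dvdn_fact// prime_gt0//= -ltnS.
rewrite -(@bin_fact (m + m) m) ?leq_addr// addnK !Euclid_dvdM//.
by rewrite (negPf (prime_gt_ndvd_fact pp mp)) !orbF.
Qed.

Lemma sum_primes_ln_double (R : realType) m :
  \sum_(m.+1 <= p < (m + m).+1 | prime p) ln p%:R <= (m + m)%:R :> R.
Proof.
have -> : \sum_(m.+1 <= p < (m + m).+1 | prime p) ln p%:R =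
    ln (\prod_(m.+1 <= p < (m + m).+1 | prime p) p)%:R :> R.
  apply: (@proj2 (0 < \prod_(m.+1 <= p < (m + m).+1 | prime p) p)%N).
  apply: (big_ind2 (fun (a : nat) (b : R) => (0 < a)%N /\ b = ln a%:R)).
  - by rewrite ln1.
  - move=> a b c d [a0 ->] [c0 ->]; rewrite muln_gt0 a0 c0; split => //.
    by rewrite natrM lnM// posrE ltr0n.
  - by move=> p pp; split; first exact: prime_gt0.
apply: le_trans (ler_ln_natr _ (prod_primes_double_le m)) _.
by rewrite natrX lnXn ?ltr0n// -(mulr_natr (ln _)) ler_piMl// ?ln2_le1//.
Qed.

(** Chebyshev's bound: the primes above [n / 2] are controlled by the central
   binomial coefficient, the others by induction. *)
Lemma prime_sum_ln_le (R : realType) n :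
  prime_sum (fun p => ln p%:R) n <= 4 * n%:R :> R.
Proof.
elim/ltn_ind: n => n IH.
have [n3|n3] := ltnP n 3.
  case: n n3 {IH} => [|[|[|//]]] _; rewrite ?prime_sumS prime_sum0 /=.
  - by rewrite mulr0.
  - lra.
  - by have := ln2_le1 R; lra.
pose m := (uphalf n); have mn : (m < n)%N by rewrite /m; lia.
apply: (@le_trans _ _ (prime_sum (fun p => ln p%:R) (m + m))).
  by apply: prime_sum_homo => [p _|]; [exact: ln_natr_ge0|rewrite /m; lia].
rewrite (@prime_sum_split _ _ m) ?leq_addr//.
apply: le_trans (lerD (IH m mn) (sum_primes_ln_double R m)) _.
(* Rounding [n / 2] up costs at most a factor 4 / 3, since [n >= 3]. *)
have mn' : (6 * m <= 4 * n)%N by rewrite /m; lia.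
by rewrite -(ler_nat R) !natrM in mn'; rewrite natrD; lra.
Qed.

Lemma powR_natrE (R : realType) n (d : R) : (0 < n)%N ->
  n%:R `^ d = expR (d * ln n%:R).
Proof. by move=> n0; rewrite /powR gt_eqF ?ltr0n. Qed.

(** The elementary form of the comparison of [n ^ (- 1 - d)] with the integral
   of [x ^ (- 1 - d)] on the two adjacent unit intervals. *)
Lemma zeta_term_bounds (R : realType) (d : R) n : 0 < d -> (0 < n)%N ->
  d * (n.+1%:R^-1 * n.+1%:R `^ (- d)) <= n%:R `^ (- d) - n.+1%:R `^ (- d)
    <= d * (n%:R^-1 * n%:R `^ (- d)).
Proof.
move=> d0 n0; rewrite !powR_natrE//.
set a := ln n%:R; set b := ln n.+1%:R; set x := n%:R^-1; set y := n.+1%:R^-1.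
have abx : b - a <= x by exact: ln_natrS_subr.
have aby : y <= b - a.
  rewrite /b /a -ln_div ?posrE ?ltr0n//.
  apply: le_trans (ln_ge_1subV _); last by rewrite divr_gt0 ?ltr0n.
  rewrite invf_div /y -[n in n%:R / _]/(n.+1.-1) -subn1 natrB//.
  by rewrite mulrBl divff ?pnatr_eq0// div1r opprB addrC subrK.
have E1 : expR (- d * b) = expR (- d * a) * expR (- d * (b - a)).
  by rewrite -expRD; congr expR; ring.
have E2 : expR (- d * a) = expR (- d * b) * expR (d * (b - a)).
  by rewrite -expRD; congr expR; ring.
have e1 := expR_ge1Dx (- d * (b - a)); have e2 := expR_ge1Dx (d * (b - a)).
apply/andP; split.
  have : d * y <= d * (b - a) by rewrite ler_pM2l.
  rewrite E2; move: e2 (expR_ge0 (- d * b)).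
  set K := expR (d * _); set B := expR _ => e2 B0 h.
  have : 0 <= B * (K - 1 - d * y) by rewrite mulr_ge0//; lra.
  lra.
have : d * (b - a) <= d * x by rewrite ler_pM2l.
rewrite E1; move: e1 (expR_ge0 (- d * a)).
set K := expR (- d * (b - a)); set A := expR _ => e1 A0 h.
have : 0 <= A * (K - 1 + d * x) by rewrite mulr_ge0//; lra.
lra.
Qed.

Lemma sum_zeta_le (R : realType) (d : R) n : 0 < d ->
  \sum_(1 <= k < n.+1) k%:R^-1 * k%:R `^ (- d) <= 1 + d^-1.
Proof.
move=> d0; case: n => [|n]; first by rewrite big_geq// addr_ge0// invr_ge0 ltW.
rewrite big_nat_recl//= invr1 powR1 mulr1 lerD2l -(ler_pM2l d0) mulfV ?gt_eqF//.
rewrite mulr_sumr; apply: (@le_trans _ _ (\sum_(1 <= k < n.+1)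
    ((- k.+1%:R `^ (- d)) - (- k%:R `^ (- d))))).
  rewrite big_nat [leRHS]big_nat; apply: ler_sum => k /andP[k0 _].
  by rewrite opprK addrC; have /andP[] := zeta_term_bounds d0 k0.
by rewrite telescope_sumr// powR1 opprK gerDr oppr_le0 powR_ge0.
Qed.

Lemma sum_zeta_ge (R : realType) (d : R) n : 0 < d ->
  (1 - n.+1%:R `^ (- d)) / d <= \sum_(1 <= k < n.+1) k%:R^-1 * k%:R `^ (- d).
Proof.
move=> d0; rewrite ler_pdivrMr// mulrC mulr_sumr.
apply: (@le_trans _ _ (\sum_(1 <= k < n.+1)
    ((- k.+1%:R `^ (- d)) - (- k%:R `^ (- d))))).
  by rewrite telescope_sumr// powR1 opprK addrC.
rewrite big_nat [leRHS]big_nat; apply: ler_sum => k /andP[k0 _].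
by rewrite opprK addrC; have /andP[] := zeta_term_bounds d0 k0.
Qed.

Lemma ln_natr_le_sqrt (R : realType) n : (0 < n)%N ->
  ln n%:R <= 2 * n%:R `^ 2^-1 :> R.
Proof.
move=> n0; rewrite powR_natrE//.
by have := expR_ge1Dx (2^-1 * ln n%:R : R); lra.
Qed.

(** [ln p = O(sqrt p)], so the sum is dominated by that of the [n ^ (- 3/2)]. *)
Lemma prime_sum_ln_sqr_le (R : realType) n :
  prime_sum (fun p => ln p%:R / p%:R ^+ 2) n <= 6 :> R.
Proof.
apply: (@le_trans _ _ (prime_sum (fun p => 2 * (p%:R^-1 * p%:R `^ (- 2^-1))) n)).
  apply: ler_prime_sum => p pp _; have p0 := prime_gt0 pp.
  have p0R : 0 < p%:R :> R by rewrite ltr0n.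
  have -> : p%:R `^ (- 2^-1) = p%:R `^ 2^-1 / p%:R :> R.
    rewrite -{3}(powRr1 (ltW p0R)) -powRN -powRD.
      by congr (_ `^ _); lra.
    by apply/implyP => _; rewrite gt_eqF.
  rewrite ler_pdivrMr ?exprn_gt0//.
  suff -> : 2 * (p%:R^-1 * (p%:R `^ 2^-1 / p%:R)) * p%:R ^+ 2 =
      2 * p%:R `^ 2^-1 :> R by exact: ln_natr_le_sqrt.
  by field; rewrite gt_eqF.
rewrite prime_sumZ.
have h : 0 < 2^-1 :> R by lra.
have := @sum_zeta_le R 2^-1 n h; rewrite invrK.
have := @prime_sum_le_sum R (fun p => p%:R^-1 * p%:R `^ (- 2^-1)) n.
rewrite /=; set a := prime_sum _ _; set b := \sum_(_ <= _ < _) _.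
move=> ab; have {}ab : a <= b.
  by apply: ab => k; rewrite mulr_ge0 ?powR_ge0 ?invr_ge0.
lra.
Qed.

Lemma ln_fact_lbound (R : realType) n :
  n%:R * ln n%:R - n%:R <= ln n`!%:R :> R.
Proof.
elim: n => [|n IH]; first by rewrite fact0 ln1 mul0r subr0.
rewrite factS natrM lnM ?posrE ?ltr0n ?fact_gt0//.
have [->|n0] := posnP n.
  by rewrite fact0 ln1; lra.
have := @ln_natrS_subr R n n0.
have n0R : 0 < n%:R :> R by rewrite ltr0n.
rewrite -(ler_pM2l n0R) mulfV ?gt_eqF// -(natr1 n).
move: IH; set a := ln n%:R; set b := ln _; lra.
Qed.

Lemma ln_fact_ubound (R : realType) n : ln n`!%:R <= n%:R * ln n%:R :> R.
Proof.
elim: n => [|n IH]; first by rewrite fact0 ln1 mul0r.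
rewrite factS natrM lnM ?posrE ?ltr0n ?fact_gt0//.
have := @ler_ln_natr R _ _ (leqnSn n).
have n0R : 0 <= n%:R :> R by rewrite ler0n.
rewrite -(natr1 n); move: IH; set a := ln n%:R; set b := ln _; nra.
Qed.

Lemma ln_prime_sum (R : realType) m n : (0 < m)%N -> (m <= n)%N ->
  ln m%:R = prime_sum (fun p => (logn p m)%:R * ln p%:R) n :> R.
Proof.
move=> m0 mn; rewrite -{1}(partnT m0) (widen_partn _ mn).
rewrite /prime_sum big_mkcond [RHS]big_mkcond /=.
apply: (@proj2 (0 < \prod_(0 <= p < n.+1) p ^ logn p m)%N).
apply: (big_ind2 (fun (a : nat) (b : R) => (0 < a)%N /\ ln a%:R = b)).
- by rewrite ln1.
- move=> a b c d [a0 <-] [c0 <-]; rewrite muln_gt0 a0 c0; split => //.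
  by rewrite natrM lnM// posrE ltr0n.
- move=> p _; case: ifPn => pp.
    rewrite expn_gt0 prime_gt0//; split => //.
    by rewrite natrX lnXn ?ltr0n ?prime_gt0// mulr_natl.
  by rewrite lognE (negPf pp) expn0 ln1.
Qed.

Lemma ln_fact_prime_sum (R : realType) n :
  ln n`!%:R = prime_sum (fun p => (logn p n`!)%:R * ln p%:R) n :> R.
Proof.
suff H m : (m <= n)%N ->
    ln m`!%:R = prime_sum (fun p => (logn p m`!)%:R * ln p%:R) n :> R.
  exact: H.
elim: m => [|m IH] mn.
  by rewrite fact0 ln1 /prime_sum big1// => p _; rewrite logn1 mul0r.
rewrite factS natrM lnM ?posrE ?ltr0n ?fact_gt0// (@ln_prime_sum R m.+1 n)//.
rewrite (IH (ltnW mn)) -prime_sumD; apply: eq_prime_sum => p pp.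
by rewrite lognM ?fact_gt0// natrD mulrDl.
Qed.

Lemma sum_geometric_le (R : realType) (x : R) n : 1 < x ->
  \sum_(1 <= k < n.+1) x ^- k <= (x - 1)^-1.
Proof.
move=> x1; have x0 : 0 < x - 1 by rewrite subr_gt0.
have x00 : 0 < x by lra.
rewrite -(ler_pM2l x0) mulfV ?gt_eqF// mulr_sumr.
(* [(x - 1) / x ^ k] is a difference of consecutive terms. *)
rewrite (eq_bigr (fun k => (x * - x ^- k.+1) - (x * - x ^- k))); last first.
  move=> k _; rewrite exprS invfM mulrN mulVKf ?gt_eqF//; ring.
rewrite (telescope_sumr (fun k => x * - x ^- k))// expr1.
rewrite !mulrN mulfV ?gt_eqF// opprK gerDr oppr_le0 mulr_ge0//.
  exact: ltW.
by rewrite invr_ge0 exprn_ge0// ltW.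
Qed.

Lemma logn_fact_bounds (R : realType) p n : prime p -> (p <= n)%N ->
  n%:R / p%:R - 1 <= ((logn p n`!)%:R : R) <= n%:R / (p%:R - 1).
Proof.
move=> pp pn; have p0 : 0 < p%:R :> R by rewrite ltr0n prime_gt0.
have p1 : 1 < p%:R :> R by rewrite ltr1n prime_gt1.
rewrite logn_fact//; apply/andP; split.
  rewrite big_ltn ?ltnS ?(leq_trans (prime_gt0 pp))// expn1 natrD.
  rewrite -[leLHS]addr0 lerD// lerBlDr ler_pdivrMr//.
  by rewrite natr1 -natrM ler_nat ltnW// ltn_ceil ?prime_gt0.
rewrite natr_sum; apply: (@le_trans _ _ (\sum_(1 <= k < n.+1) n%:R * p%:R ^- k)).
  apply: ler_sum => k _; rewrite ler_pdivlMr ?exprn_gt0//.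
  by rewrite -natrX -natrM ler_nat leq_trunc_div.
by rewrite -mulr_sumr ler_wpM2l// sum_geometric_le.
Qed.

(** Mertens' first theorem: by Legendre's formula, [ln n!], which is
   [n ln n + O(n)], is [n] times the sum up to [O(n)], the error coming from
   the integer parts (controlled by Chebyshev's bound) and from the prime
   powers (a convergent sum). *)
Lemma mertens1 (R : realType) n : (0 < n)%N ->
  `|prime_sum (fun p => ln p%:R / p%:R) n - ln n%:R| <= 13 :> R.
Proof.
move=> n0; have n0R : 0 < n%:R :> R by rewrite ltr0n.
set A := prime_sum _ _.
have up : n%:R * A - 4 * n%:R <= n%:R * ln n%:R.
  apply: le_trans (ln_fact_ubound R n); rewrite ln_fact_prime_sum.
  apply: (@le_trans _ _ (n%:R * A - prime_sum (fun p => ln p%:R) n)).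
    by rewrite lerB// prime_sum_ln_le.
  rewrite -prime_sumZ -prime_sumB; apply: ler_prime_sum => p pp pn.
  have /andP[+ _] := @logn_fact_bounds R p n pp pn.
  have := @ln_natr_ge0 R p; set l := ln _; set g := (logn _ _)%:R => l0 h.
  have -> : n%:R * (l / p%:R) - l = (n%:R / p%:R - 1) * l.
    by rewrite mulrBl mul1r mulrA mulrAC.
  by rewrite ler_wpM2r.
have low : n%:R * ln n%:R - n%:R <= n%:R * (A + 12).
  apply: le_trans (ln_fact_lbound R n) _; rewrite ln_fact_prime_sum.
  apply: (@le_trans _ _
    (n%:R * (A + 2 * prime_sum (fun p => ln p%:R / p%:R ^+ 2) n))); last first.
    rewrite ler_wpM2l ?ler0n// lerD2l.
    by have := @prime_sum_ln_sqr_le R n; lra.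
  rewrite -prime_sumZ -prime_sumD -prime_sumZ; apply: ler_prime_sum => p pp pn.
  have /andP[_ h] := @logn_fact_bounds R p n pp pn.
  have l0 := @ln_natr_ge0 R p.
  apply: (@le_trans _ _ (n%:R / (p%:R - 1) * ln p%:R)); first by rewrite ler_wpM2r.
  (* [1 / (p - 1) <= 1 / p + 2 / p ^ 2], as [p >= 2]. *)
  have p2 : 2 <= p%:R :> R by rewrite ler_nat prime_gt1.
  rewrite -mulrA ler_wpM2l ?ler0n//.
  have -> : ln p%:R / p%:R + 2 * (ln p%:R / p%:R ^+ 2) =
      (p%:R^-1 + 2 * p%:R ^- 2) * ln p%:R :> R by ring.
  rewrite ler_wpM2r// -subr_ge0.
  have -> : p%:R^-1 + 2 * p%:R ^- 2 - (p%:R - 1)^-1 =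
     (p%:R - 2) / (p%:R ^+ 2 * (p%:R - 1)) :> R.
    by field; apply/andP; split; apply: lt0r_neq0; lra.
  by apply: divr_ge0; [lra|apply: mulr_ge0; [exact: sqr_ge0|lra]].
move: up low; rewrite ler_norml.
have -> : n%:R * A - 4 * n%:R = n%:R * (A - 4) by ring.
have -> : n%:R * ln n%:R - n%:R = n%:R * (ln n%:R - 1) :> R by ring.
rewrite !ler_pM2l//; set l := ln _; lra.
Qed.

(** * Mertens' second theorem *)

Lemma cvgy_ln (R : realType) (T : Type) (F : set_system T) {FF : Filter F}
  (f : T -> R) : f x @[x --> F] --> +oo -> ln (f x) @[x --> F] --> +oo.
Proof.
move=> /cvgryPge fy; apply/cvgryPge => A; have := fy (expR A).
apply: filterS => x Ax; rewrite -(expRK A) ler_ln ?posrE ?expR_gt0//.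
exact: lt_le_trans (expR_gt0 _) Ax.
Qed.

Lemma cvgy_inv (R : realType) (T : Type) (F : set_system T) {FF : Filter F}
  (f : T -> R) : f x @[x --> F] --> +oo -> (f x)^-1 @[x --> F] --> (0 : R).
Proof.
move=> fy; apply/gtr0_cvgV0 => //.
by move/cvgryPgt : fy; exact.
Qed.

Lemma cvg_bounded_mul0 (R : realType) (T : Type) (F : set_system T)
  {FF : Filter F} (f g : T -> R) (K : R) :
  (\forall x \near F, `|f x| <= K) -> g x @[x --> F] --> (0 : R) ->
  f x * g x @[x --> F] --> (0 : R).
Proof.
move=> fK g0; apply/cvgr0Pnorm_le => e e0.
have K0 : 0 < Num.max K 0 + 1 by rewrite ltr_wpDl// le_max lexx orbT.
have gK := cvgr0_norm_le _ g0 _ (divr_gt0 e0 K0).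
near=> x.
have fx : `|f x| <= K by near: x; exact: fK.
have gx : `|g x| <= e / (Num.max K 0 + 1) by near: x; exact: gK.
rewrite normrM.
apply: (@le_trans _ _ ((Num.max K 0 + 1) * (e / (Num.max K 0 + 1)))).
  rewrite ler_pM//; apply: le_trans fx _.
  by rewrite -[leLHS]addr0 lerD// le_max lexx.
by rewrite mulrCA divff ?gt_eqF// mulr1.
Unshelve. all: by end_near. Qed.

Lemma cvgn_ln_natr (R : realType) : (ln n%:R : R) @[n --> \oo] --> +oo.
Proof. apply: cvgy_ln; exact: cvgr_idn. Qed.

Lemma cvgn_lnln_natr (R : realType) : (ln (ln n%:R) : R) @[n --> \oo] --> +oo.
Proof. apply: cvgy_ln; exact: cvgn_ln_natr. Qed.

(** Summation by parts turns the first theorem, with error term [r], into the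
   second: the error contributes [r n / ln n] plus a sum of
   [r n (1 / ln n - 1 / ln (n + 1))]. As [r] is bounded by 13, subtracting the
   former and adding [13 / ln n] makes the sequence, [Y] below, nonincreasing. *)
Lemma mertens2 (R : realType) : exists c : R,
  prime_sum (fun p => p%:R^-1) n - ln (ln n%:R) @[n --> \oo] --> c.
Proof.
pose l n : R := ln n%:R; pose q n : R := (l n)^-1.
pose A n : R := prime_sum (fun p => ln p%:R / p%:R) n.
pose r n : R := A n - l n.
pose M n : R := prime_sum (fun p => p%:R^-1) n.
pose Y n : R := M n - ln (l n) - r n * q n + 13 * q n.
have stepM n : M n.+1 - M n = (A n.+1 - A n) * q n.+1.
  rewrite /M /A !prime_sumS; case: ifPn => pn; last by ring.
  have l0 : 0 < l n.+1 by rewrite ln_natr_gt0// prime_gt1.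
  rewrite /q /l; rewrite /l in l0; set x := prime_sum _ _; set y := prime_sum _ _.
  by field; rewrite gt_eqF//= pnatr_eq0.
(* 27 is twice the bound on [r], plus 1 for the convexity error [f]. *)
have stepY n : (1 < n)%N -> 0 <= q n - q n.+1 /\
    - 27 * (q n - q n.+1) <= Y n.+1 - Y n <= 0.
  move=> n1; have n0 : (0 < n)%N by apply: ltnW.
  have l0 : 0 < l n by rewrite ln_natr_gt0.
  have l0' : 0 < l n.+1 by rewrite ln_natr_gt0// ltnS ltnW.
  have ll : l n <= l n.+1 by apply: ler_ln_natr.
  have l1 : l n.+1 - l n <= 1.
    apply: le_trans (ln_natrS_subr _ n0) _.
    by rewrite invf_le1 ?ltr0n// ler1n.
  have qq : 0 <= q n - q n.+1 by rewrite subr_ge0 lef_pV2 ?posrE.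
  have /andP[r1 r2] : -13 <= r n <= 13 by rewrite -ler_norml mertens1.
  pose f := (l n.+1 - l n) * q n.+1 - (ln (l n.+1) - ln (l n)).
  have E : Y n.+1 - Y n = f + r n * (q n - q n.+1) - 13 * (q n - q n.+1).
    have -> : Y n.+1 - Y n = (M n.+1 - M n) - (ln (l n.+1) - ln (l n))
        - (r n.+1 * q n.+1 - r n * q n) - 13 * (q n - q n.+1).
      by rewrite /Y; ring.
    by rewrite stepM /f /r; ring.
  have f0 : f <= 0.
    have := @ln_ge_1subV R (l n.+1 / l n) (divr_gt0 l0' l0).
    rewrite ln_div ?posrE// invf_div /f mulrBl /q mulfV ?gt_eqF//; lra.
  have f1 : - (q n - q n.+1) <= f.
    have := @ln_le_subr1 R (l n.+1 / l n) (divr_gt0 l0' l0).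
    rewrite ln_div ?posrE// => h.
    have h2 : (l n.+1 - l n) * (q n - q n.+1) <= q n - q n.+1.
      by rewrite -[leRHS]mul1r ler_wpM2r.
    have h3 : (l n.+1 - l n) * q n = l n.+1 / l n - 1.
      by rewrite mulrBl /q mulfV ?gt_eqF.
    by rewrite /f; move: h2; rewrite mulrBr h3; lra.
  split => //; rewrite E.
  have a1 : r n * (q n - q n.+1) <= 13 * (q n - q n.+1) by rewrite ler_wpM2r.
  have a2 : - 13 * (q n - q n.+1) <= r n * (q n - q n.+1) by rewrite ler_wpM2r.
  by lra.
have q0 : q n @[n --> \oo] --> (0 : R) by apply: cvgy_inv; exact: cvgn_ln_natr.
have /cvg_ex[c Yc] : cvgn Y.
  suff /cvg_ex[c Yc] : cvgn (fun n => Y n.+2).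
    apply/cvg_ex; exists c; rewrite -cvg_shiftS.
    by move: Yc; rewrite (@cvg_shiftS _ (fun n => Y n.+1)).
  apply: nonincreasing_is_cvgn.
    apply/nonincreasing_seqP => n.
    by have [_ /andP[_]] := stepY n.+2 isT; rewrite subr_le0.
  exists (Y 2 - 27 * q 2) => _ [n _ <-].
  have q2 : 0 <= 27 * q n.+2.
    by rewrite mulr_ge0// invr_ge0 ln_natr_ge0.
  suff : Y 2 - 27 * q 2 <= Y n.+2 - 27 * q n.+2 by lra.
  elim: n {q2} => // n IH; apply: le_trans IH _.
  have [_ /andP[+ _]] := stepY n.+2 isT.
  by move: (Y n.+2) (Y n.+3) (q n.+2) (q n.+3) => y1 y2 q1 q2' ?; lra.
exists c.
rewrite (_ : (fun n => _) = fun n => Y n + (r n - 13) * q n); last first.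
  by apply/funext => n; rewrite /Y /M /l; ring.
rewrite -[X in _ --> X]addr0; apply: cvgD; first exact: Yc.
apply: (@cvg_bounded_mul0 _ _ _ _ _ _ 26) q0.
near=> n; have := @mertens1 R n.
have -> : (0 < n)%N by near: n; exact: nbhs_infty_gt.
rewrite -/(A n) -/(l n) -/(r n) => /(_ isT) h.
by apply: le_trans (ler_normB _ _) _; rewrite [`|13|]ger0_norm//; lra.
Unshelve. all: by end_near. Qed.

(** * Euler products *)

(** [Omega N] is [smooth (nth_prime N)]; a bound on the value of the primes
   instead of their index allows inductions through all the integers. *)
Definition smooth (Y : nat) : set nat :=
  [set m | (0 < m)%N /\ forall p, prime p -> (p %| m)%N -> (p <= Y)%N].

Lemma leq_nth_prime j : (j <= nth_prime j)%N.
Proof. by elim: j => // j IH; exact: leq_ltn_trans IH (nth_prime_lt j). Qed.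

Lemma nth_prime_leq i j : (i <= j)%N -> (nth_prime i <= nth_prime j)%N.
Proof.
elim: j => [|j IH]; first by rewrite leqn0 => /eqP ->.
rewrite leq_eqVlt => /predU1P[->//|]; rewrite ltnS => /IH ij.
exact: leq_trans ij (ltnW (nth_prime_lt j)).
Qed.

Lemma smooth_sub_Omega Y : smooth Y `<=` Omega Y.
Proof.
move=> m [m0 mY]; split => // -[//|j] Yj; apply/negP => pm.
have := mY _ (nth_primeS_prime j) pm; rewrite leqNgt => /negP; apply.
exact: leq_trans Yj (leq_nth_prime _).
Qed.

Lemma Omega_smooth N : Omega N = smooth (nth_prime N).
Proof.
apply/seteqP; split=> m [m0 mN]; split => //.
  move=> p pp pm; rewrite leqNgt; apply/negP => Np.
  have [j j0 jp] := nth_prime_surj pp.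
  have Nj : (N < j)%N.
    by rewrite ltnNge; apply: contraTN Np => /nth_prime_leq; rewrite jp -leqNgt.
  by have := mN j Nj; rewrite jp pm.
move=> [//|j] Nj; apply/negP => pm.
have := mN _ (nth_primeS_prime j) pm.
by rewrite leqNgt (leq_trans (nth_prime_lt N))//; exact: nth_prime_leq.
Qed.

Section esum_nat.
Variables (R : realType) (A : set nat) (f : nat -> R).
Hypothesis f0 : forall n, 0 <= f n.

Let esumE : \esum_(n in A) (f n)%:E = (\sum_(0 <= n <oo | n \in A) (f n)%:E)%E.
Proof.
by rewrite nneseries_esum ?set_mem_set// => n _; rewrite lee_fin.
Qed.

Lemma esum_nat_le (K : R) :
  (forall n, \sum_(0 <= k < n | k \in A) f k <= K) ->
  (\esum_(n in A) (f n)%:E <= K%:E)%E.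
Proof.
move=> fK; rewrite esumE; apply: lime_le.
  by apply: is_cvg_nneseries => n _ _; rewrite lee_fin.
by apply: nearW => n; rewrite sumEFin lee_fin.
Qed.

Lemma esum_nat_ge n :
  ((\sum_(0 <= k < n | k \in A) f k)%:E <= \esum_(n in A) (f n)%:E)%E.
Proof.
rewrite esumE -sumEFin; apply: nneseries_lim_ge => k _ _.
by rewrite lee_fin.
Qed.

Lemma esum_nat_bounded n : (forall k, A k -> (k < n)%N) ->
  \esum_(n in A) (f n)%:E = (\sum_(0 <= k < n | k \in A) f k)%:E.
Proof.
move=> An; apply/eqP; rewrite eq_le esum_nat_ge andbT; apply: esum_nat_le => m.
have [mn|nm] := leqP m n.
  by rewrite [leRHS](big_cat_nat (n := m))//= lerDl sumr_ge0.
rewrite (big_cat_nat (n := n)) ?(ltnW nm)//= [X in _ + X]big_nat_cond.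
rewrite [X in _ + X]big1 ?addr0// => k /andP[/andP[nk _]].
by rewrite inE => /An; rewrite ltnNge nk.
Qed.

Lemma esum_natZl (c : R) : 0 <= c ->
  (\esum_(n in A) (c * f n)%:E = c%:E * \esum_(n in A) (f n)%:E)%E.
Proof.
move=> c0; rewrite esumE -nneseriesZl ?lee_fin//; last first.
  by move=> n _; rewrite lee_fin.
rewrite nneseries_esum ?set_mem_set// => n _.
by rewrite lee_fin mulr_ge0.
Qed.

End esum_nat.

Lemma le_esum_subset (R : realType) (A B : set nat) (f g : nat -> R) :
  A `<=` B -> (forall n, 0 <= f n) -> (forall n, f n <= g n) ->
  (\esum_(n in A) (f n)%:E <= \esum_(n in B) (g n)%:E)%E.
Proof.
move=> AB f0 fg; rewrite esum_mkcond [leRHS]esum_mkcond; apply: le_esum => n _.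
case: ifPn => [|_]; first by rewrite inE => /AB An; rewrite mem_set// lee_fin.
by case: ifP => // _; rewrite lee_fin (le_trans (f0 n)).
Qed.

Section euler_product.
Variables (R : realType) (f : nat -> R).
Hypothesis f1 : f 1%N = 1.
Hypothesis fM : forall m n, f (m * n)%N = f m * f n.
Hypothesis f0 : forall n, 0 <= f n.
Hypothesis fV : forall n, f n <= n%:R^-1.

Let prime_f_lt1 p : prime p -> f p < 1.
Proof.
move=> pp; apply: le_lt_trans (fV p) _.
by rewrite invf_lt1 ?ltr0n ?prime_gt0// ltr1n prime_gt1.
Qed.

(* The sums are finite since they are dominated by [C Y]. *)
Let esum_fin Y : \esum_(m in smooth Y) (f m)%:E \is a fin_num.
Proof.
rewrite ge0_fin_numE; last by apply: esum_ge0 => n _; rewrite lee_fin.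
apply: le_lt_trans (le_esum_subset (@smooth_sub_Omega Y) f0 fV) _.
by rewrite C_EFin ltry.
Qed.

(* The multiples of the prime [p] among the [p]-smooth numbers are the [p * m]
   with [m] itself [p]-smooth, so that the new sum also appears on the right. *)
Let esum_smoothS Y : prime Y.+1 ->
  (\esum_(m in smooth Y.+1) (f m)%:E = \esum_(m in smooth Y) (f m)%:E +
   (f Y.+1)%:E * \esum_(m in smooth Y.+1) (f m)%:E)%E.
Proof.
move=> pp; rewrite {1}(esumID [set m | ~~ (Y.+1 %| m)%N]); last first.
  by move=> n _; rewrite lee_fin.
congr (_ + _)%E.
  congr (esum _ _); apply/seteqP; split=> m /=.
    move=> [[m0 mY] /= Ym]; split => // p p' pm.
    have := mY p p' pm; rewrite leq_eqVlt => /predU1P[pY|//].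
    by move: Ym; rewrite -pY pm.
  move=> [m0 mY]; split; first by split => // p p' /(mY _ p') /leqW.
  by apply/negP => /(mY _ pp); rewrite ltnn.
rewrite -esum_natZl//.
rewrite (@reindex_esum _ _ _ (smooth Y.+1) _ (fun m => (Y.+1 * m)%N)).
  by apply: eq_esum => m _; rewrite fM.
split.
- move=> m [m0 mY] /=; split; last by apply/negP; rewrite negbK dvdn_mulr.
  split=> [|p p' /=]; first by rewrite muln_gt0.
  rewrite Euclid_dvdM// => /orP[|/(mY _ p')//].
  by move=> /dvdn_leq; apply.
- by move=> m n _ _ /eqP; rewrite eqn_pmul2l// => /eqP.
- move=> n [[n0 nY]] /= /negP; rewrite negbK => /dvdnP[m nm].
  have m0 : (0 < m)%N by case: m nm n0 => // ->.
  exists m; last by rewrite nm mulnC.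
  by split => // p p' pm; apply: nY => //; rewrite nm dvdn_mulr.
Qed.

(** Solving [S' = S + f p * S'] for [S'] gives the factor of the prime [p]. The
   product is written as the exponential of a sum over primes. *)
Lemma euler_product Y : \esum_(m in smooth Y) (f m)%:E =
  (expR (prime_sum (fun p => - ln (1 - f p)) Y))%:E.
Proof.
elim: Y => [|Y IH].
  have -> : smooth 0 = [set 1%N].
    apply/seteqP; split=> m /=; last first.
      by move=> ->; split => // p pp; rewrite dvdn1 => /eqP p1; rewrite p1 in pp.
    move=> [m0 mp]; apply/eqP; rewrite eqn_leq m0 andbT leqNgt.
    apply/negP => m1; have := mp _ (pdiv_prime m1) (pdiv_dvd m).
    by rewrite leqNgt prime_gt0// pdiv_prime.
  by rewrite esum_set1 ?lee_fin// f1 prime_sum0 expR0.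
rewrite prime_sumS; case: ifPn => pY; last first.
  rewrite addr0 -IH; congr (esum _ _); apply/seteqP; split=> m [m0 mY];
    split=> // p pp /(mY _ pp); last exact: leqW.
  by rewrite leq_eqVlt => /predU1P[pY'|//]; rewrite pY' (negPf pY) in pp.
have f1' : 0 < 1 - f Y.+1 by rewrite subr_gt0 prime_f_lt1.
have := esum_smoothS pY; have := esum_fin Y.+1; rewrite IH.
case: (esum _ _) => // S _; rewrite -EFinM -EFinD => -[SE]; congr EFin.
rewrite expRD expRN lnK ?posrE//.
by apply: (mulIf (lt0r_neq0 f1')); rewrite divfK ?gt_eqF//; lra.
Qed.

End euler_product.

Lemma C_prime_sum (R : realType) N :
  ln (C N) = prime_sum (fun p => - ln (1 - p%:R^-1)) (nth_prime N) :> R.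
Proof.
apply: expR_inj; rewrite lnK ?posrE ?C_gt0//; apply: EFin_inj.
rewrite -C_EFin Omega_smooth euler_product ?invr1//.
by move=> m n; rewrite natrM invfM.
Qed.

Section zeta.
Variables (R : realType) (d : R).
Hypothesis d0 : 0 < d.

Let f n : R := n%:R^-1 * n%:R `^ (- d).

Let f0 n : 0 <= f n.
Proof. by rewrite mulr_ge0 ?powR_ge0 ?invr_ge0. Qed.

Let zetaE Y : \esum_(m in smooth Y) (f m)%:E =
  (expR (prime_sum (fun p => - ln (1 - f p)) Y))%:E.
Proof.
apply: euler_product => //.
- by rewrite /f invr1 powR1 mulr1.
- by move=> m n; rewrite /f natrM invfM powRM// mulrACA.
- move=> n; rewrite /f ler_piMr ?invr_ge0// powRN.
  case: n => [|n]; first by rewrite powR0 ?gt_eqF// invr0.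
  rewrite invf_le1 ?powR_gt0 ?ltr0n// powR_natrE//.
  apply: le_trans (expR_ge1Dx _).
  by rewrite lerDl mulr_ge0 ?ln_natr_ge0// ltW.
Qed.

Lemma log_zeta_le Y : prime_sum (fun p => - ln (1 - f p)) Y <= ln (1 + d^-1).
Proof.
have d1 : 0 < 1 + d^-1 by rewrite addr_gt0// invr_gt0.
rewrite -ler_expR lnK ?posrE// -lee_fin -zetaE; apply: esum_nat_le => // n.
apply: le_trans (sum_zeta_le n d0).
rewrite big_mkcond; case: n => [|n].
  by rewrite big_geq// sumr_ge0.
rewrite big_nat_recl//= /f invr0 mul0r if_same add0r.
rewrite [leRHS]big_add1 /= [leRHS]big_nat_recr//= -[leLHS]addr0 lerD//.
by apply: ler_sum => k _; case: ifP.
Qed.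

Lemma log_zeta_ge Y : (0 < Y)%N -> ln ((1 - Y.+1%:R `^ (- d)) / d) <=
  prime_sum (fun p => - ln (1 - f p)) Y.
Proof.
move=> Y0.
have Y1 : 0 < (1 - Y.+1%:R `^ (- d)) / d.
  rewrite divr_gt0// subr_gt0 powRN invf_lt1 ?powR_gt0 ?ltr0n//.
  by rewrite powR_natrE// expR_gt1 mulr_gt0// ln_natr_gt0//.
rewrite -ler_expR lnK ?posrE// -lee_fin -zetaE.
apply: le_trans (esum_nat_ge _ f0 Y.+1); rewrite lee_fin.
apply: le_trans (sum_zeta_ge Y d0) _.
rewrite [leRHS]big_mkcond [leRHS]big_nat_recl//= [leLHS]big_add1 /=.
rewrite -[leLHS]add0r lerD//; first by case: ifP.
rewrite big_nat [leRHS]big_nat; apply: ler_sum => k /andP[_ kY].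
rewrite mem_set//; split => // p pp /dvdn_leq => /(_ isT) pk.
exact: leq_trans pk kY.
Qed.

End zeta.

(** * Mertens' third theorem *)

(** The logarithm of the divergent Euler product for zeta(1), truncated. *)
Definition log_euler (R : realType) (n : nat) : R :=
  prime_sum (fun p => - ln (1 - p%:R^-1)) n.

Lemma prime_inv_le_half (R : realType) p : prime p -> p%:R^-1 <= 2^-1 :> R.
Proof.
by move=> pp; rewrite lef_pV2 ?posrE ?ltr0n ?prime_gt0// ler_nat prime_gt1.
Qed.

Lemma log_euler_factor_bounds (R : realType) (x : R) : 0 <= x <= 2^-1 ->
  x <= - ln (1 - x) <= x + 2 * x ^+ 2.
Proof.
move=> /andP[x0 x2]; have h : 0 < 1 - x by lra.
have := ln_le_subr1 h; have := ln_ge_1subV h => h1 h2.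
have h3 : (1 - x)^-1 <= 1 + x + 2 * x ^+ 2.
  rewrite -[leLHS]mul1r ler_pdivrMr//; nra.
by apply/andP; split; lra.
Qed.

Lemma cvg_nat_ge (f : nat -> nat) : (forall n, (n <= f n)%N) ->
  f n @[n --> \oo] --> \oo.
Proof.
move=> fn A [N _ NA]; exists N => // n /= Nn; apply: NA => /=.
exact: leq_trans Nn (fn n).
Qed.

(** The logarithm of [1 / (1 - 1 / p)] is [1 / p] up to a summable error. *)
Lemma log_euler_cvg (R : realType) : exists k : R,
  log_euler R n - ln (ln n%:R) @[n --> \oo] --> k.
Proof.
have [c Mc] := mertens2 R.
pose g p : R := - ln (1 - p%:R^-1) - p%:R^-1.
have g0 p : prime p -> 0 <= g p <= 2 * (p%:R^-1 * p%:R^-1).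
  move=> pp; have := @log_euler_factor_bounds R p%:R^-1.
  by rewrite invr_ge0 ler0n prime_inv_le_half// => /(_ isT); rewrite /g; lra.
have /cvg_ex[l gl] : cvgn (prime_sum g).
  apply: nondecreasing_is_cvgn.
    by move=> m n mn; apply: prime_sum_homo => // p /g0 /andP[].
  exists 4 => _ [n _ <-].
  apply: (@le_trans _ _ (prime_sum (fun p => 2 * (p%:R^-1 * p%:R^-1)) n)).
    by apply: ler_prime_sum => p /g0 /andP[].
  rewrite prime_sumZ.
  have := @prime_sum_le_sum R (fun p => p%:R^-1 * p%:R^-1) n.
  have := @sum_zeta_le R 1 n ltr01; rewrite invr1.
  rewrite (eq_bigr (fun k => k%:R^-1 * k%:R^-1)); last first.
    by move=> k _; rewrite powR_inv1.
  set a := prime_sum _ _; set b := \sum_(_ <= _ < _) _ => ba ab.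
  have {}ab : a <= b by apply: ab => k; rewrite mulr_ge0 ?invr_ge0.
  lra.
exists (c + l).
rewrite (_ : (fun n => _) = fun n =>
    (prime_sum (fun p => p%:R^-1) n - ln (ln n%:R)) + prime_sum g n); last first.
  by apply/funext => n; rewrite /g prime_sumB /log_euler; ring.
exact: cvgD.
Qed.

(** Weighting a factor by [t] or scaling its argument by [t] makes a difference
   which is not only quadratic in [x] but also proportional to [1 - t]: for
   [t = p ^ (- d)] it vanishes with [d]. *)
Lemma log_euler_factor_scale (R : realType) (x t : R) :
  0 <= x <= 2^-1 -> 0 < t <= 1 ->
  `|t * - ln (1 - x) - - ln (1 - x * t)| <= 2 * (1 - t) * x ^+ 2.
Proof.
move=> /andP[x0 x2] /andP[t0 t1].
have h1 : 0 < 1 - x by lra.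
have h2 : 0 < 1 - x * t by nra.
have y0 : 0 < (1 - x * t) / (1 - x) by rewrite divr_gt0.
have := ln_le_subr1 y0; have := ln_ge_1subV y0.
rewrite ln_div ?posrE// invf_div.
have := ln_le_subr1 h1; have := ln_ge_1subV h1.
set a := ln (1 - x); set b := ln (1 - x * t) => a1 a2 b1 b2.
have E1 : (1 - x * t) / (1 - x) - 1 = (1 - t) * (x / (1 - x)).
  by field; rewrite gt_eqF.
have E2 : 1 - (1 - x) / (1 - x * t) = (1 - t) * (x / (1 - x * t)).
  by field; rewrite gt_eqF.
have E3 : 1 - (1 - x)^-1 = - (x / (1 - x)) by field; rewrite gt_eqF.
rewrite E1 in b2; rewrite E2 in b1; rewrite E3 in a1.
have x1 : x / (1 - x) <= x + 2 * x ^+ 2 by rewrite ler_pdivrMr//; nra.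
have x3 : x <= x / (1 - x * t).
  by rewrite ler_pdivlMr//; rewrite -[leRHS]mulr1 ler_wpM2l// gerBl mulr_ge0// ltW.
have E : t * - a - - b = (b - a) + (1 - t) * a by ring.
have t1' : 0 <= 1 - t by lra.
have c1 : (1 - t) * a <= (1 - t) * - x by rewrite ler_wpM2l//; lra.
have c2 : (1 - t) * (- (x / (1 - x))) <= (1 - t) * a by rewrite ler_wpM2l.
have c3 : (1 - t) * (x / (1 - x)) <= (1 - t) * (x + 2 * x ^+ 2) by rewrite ler_wpM2l.
have c4 : (1 - t) * x <= (1 - t) * (x / (1 - x * t)) by rewrite ler_wpM2l.
rewrite E ler_norml; apply/andP; split; lra.
Qed.

Lemma powR_opp_bounds (R : realType) (d : R) n : 0 <= d -> (0 < n)%N ->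
  (0 < n%:R `^ (- d) <= 1) /\ 1 - n%:R `^ (- d) <= d * ln n%:R.
Proof.
move=> d0 n0; rewrite powR_gt0 ?ltr0n// powR_natrE//.
have l0 := @ln_natr_ge0 R n; have := expR_ge1Dx (- d * ln n%:R : R) => h.
split; last by lra.
by rewrite /= expR_le1 mulNr oppr_le0 mulr_ge0.
Qed.

(** Discounting the terms of [log_euler] by [p ^ (- d)] gives the logarithm of
   the Euler product for zeta(1 + d), up to [O(d)] uniformly in [n]. *)
Lemma log_euler_discount (R : realType) (d : R) n : 0 < d ->
  `|prime_sum (fun p => p%:R `^ (- d) * - ln (1 - p%:R^-1)) n
    - prime_sum (fun p => - ln (1 - p%:R^-1 * p%:R `^ (- d))) n| <= 12 * d.
Proof.
move=> d0; rewrite -prime_sumB.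
apply: le_trans (ler_norm_sum _ _ _) _.
apply: (@le_trans _ _ (prime_sum (fun p => 2 * d * (ln p%:R / p%:R ^+ 2)) n)).
  apply: ler_prime_sum => p pp _.
  have [t01 t1] := powR_opp_bounds (ltW d0) (prime_gt0 pp).
  apply: le_trans (log_euler_factor_scale _ t01) _.
    by rewrite invr_ge0 ler0n prime_inv_le_half.
  rewrite -exprVn [leRHS]mulrA -[X in _ <= X * _]mulrA.
  by rewrite ler_wpM2r ?exprn_ge0 ?invr_ge0// ler_wpM2l.
rewrite prime_sumZ; have := @prime_sum_ln_sqr_le R n.
set S := prime_sum _ _ => S6; nra.
Qed.

(** Grouping the primes in dyadic blocks replaces the weight [p ^ (- d)] by a
   power of [r = 2 ^ (- d)], at the cost of at most a factor [r]. *)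
Lemma log_euler_dyadic (R : realType) (d : R) K : 0 < d ->
  let r := 2 `^ (- d) in
  let W := prime_sum (fun p => p%:R `^ (- d) * - ln (1 - p%:R^-1)) (2 ^ K) in
  let V := \sum_(0 <= n < K)
    (log_euler R (2 ^ n.+1) - log_euler R (2 ^ n)) * r ^+ n.+1 in
  r * W <= V <= W.
Proof.
move=> d0 /=; set r := 2 `^ (- d).
have rE n : (2 ^ n)%:R `^ (- d) = r ^+ n :> R.
  rewrite /r !powR_natrE ?expn_gt0// -expRM_natl natrX lnXn ?ltr0n//.
  by congr expR; rewrite -(mulr_natl (ln _)) mulrCA.
have l0 p : prime p -> 0 <= - ln (1 - p%:R^-1) :> R.
  move=> pp; have := @log_euler_factor_bounds R p%:R^-1.
  rewrite invr_ge0 ler0n prime_inv_le_half// => /(_ isT) /andP[+ _].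
  by apply: le_trans; rewrite invr_ge0.
have homo (m n : nat) : (0 < m)%N -> (m <= n)%N ->
    n%:R `^ (- d) <= m%:R `^ (- d) :> R.
  move=> m0 mn; rewrite !powR_natrE// ?(leq_trans m0 mn)//.
  by rewrite ler_expR !mulNr lerN2 ler_pM2l// ler_ln_natr.
elim: K => [|K]; first by rewrite big_geq// prime_sumS prime_sum0 addr0 mulr0 lexx.
have pK : (2 ^ K <= 2 ^ K.+1)%N by rewrite leq_exp2l.
rewrite big_nat_recr//= (prime_sum_split _ pK) /log_euler (prime_sum_split _ pK).
rewrite -/(log_euler R (2 ^ K)) mulrDr addrAC subrr add0r.
set W := prime_sum _ _; set V := \sum_(0 <= n < K) _ => /andP[IH1 IH2].
apply/andP; split; apply: lerD => //; rewrite ?mulr_sumr mulr_suml.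
  rewrite big_nat_cond [leRHS]big_nat_cond; apply: ler_sum => p /andP[/andP[Kp _] pp].
  rewrite mulrA mulrC ler_wpM2l ?l0// exprS ler_wpM2l ?powR_ge0// -rE.
  by rewrite homo ?expn_gt0// ltnW.
rewrite big_nat_cond [leRHS]big_nat_cond; apply: ler_sum => p /andP[/andP[_ pK'] pp].
by rewrite mulrC ler_wpM2r ?l0// -rE homo ?prime_gt0// -ltnS.
Qed.

(** Abel's theorem on power series, stated on the partial sums: by summation by
   parts they are averages of [D], in which the terms before any given rank
   have a total weight [O(1 - r)]. The rank [K] need not grow with [r], since the
   boundary term [(D K - l) * r ^ K] is small by itself. *)
Lemma abel_theorem (R : realType) (D : nat -> R) (l : R) : D 0%N = 0 ->
  D n @[n --> \oo] --> l -> forall e : R, 0 < e ->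
  exists2 eta : R, 0 < eta & forall r : R, 0 < r < 1 -> 1 - r <= eta ->
    \forall K \near \oo,
      `|\sum_(0 <= n < K) (D n.+1 - D n) * r ^+ n.+1 - l| <= e.
Proof.
move=> D0 Dl e e0; have e3 : 0 < e / 3 by rewrite divr_gt0.
have [N _ DN] := cvgr_distC_le _ _ Dl _ e3.
pose B := \sum_(0 <= n < N) `|D n - l|.
have B0 : 0 <= B by exact: sumr_ge0.
have B1 : 0 < B + 1 by lra.
exists (e / 3 / (B + 1)) => [|r /andP[r0 r1] reta]; first exact: divr_gt0.
exists N => // K /= NK.
have r1' : 0 <= 1 - r by lra.
have -> : \sum_(0 <= n < K) (D n.+1 - D n) * r ^+ n.+1 - l =
    (D K - l) * r ^+ K + (1 - r) * \sum_(0 <= n < K) (D n - l) * r ^+ n.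
  elim: K {NK} => [|K IH]; first by rewrite !big_geq// D0; ring.
  rewrite !big_nat_recr//= -addrA (addrC _ (- l)) addrA IH.
  by rewrite !exprS; ring.
have rK n : 0 <= r ^+ n <= 1 by rewrite exprn_ge0 ?exprn_ile1// ltW.
have a1 : `|(D K - l) * r ^+ K| <= e / 3.
  rewrite normrM -[leRHS]mulr1 ler_pM//; first exact: DN.
  by have /andP[a b] := rK K; rewrite ger0_norm.
have a2 : `|\sum_(0 <= n < N) (D n - l) * r ^+ n| <= B.
  apply: le_trans (ler_norm_sum _ _ _) _; apply: ler_sum => n _.
  by have /andP[a b] := rK n; rewrite normrM [`|r ^+ n|]ger0_norm// ler_piMr.
have a3 : (1 - r) * `|\sum_(N <= n < K) (D n - l) * r ^+ n| <= e / 3.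
  apply: (@le_trans _ _ ((1 - r) * \sum_(0 <= n < K) (e / 3) * r ^+ n)).
    rewrite ler_wpM2l//; apply: le_trans (ler_norm_sum _ _ _) _.
    apply: (@le_trans _ _ (\sum_(N <= n < K) (e / 3) * r ^+ n)).
      rewrite big_nat [leRHS]big_nat; apply: ler_sum => n /andP[Nn _].
      have /andP[a b] := rK n; rewrite normrM [`|r ^+ n|]ger0_norm//.
      by rewrite ler_wpM2r//; exact: DN.
    rewrite [leRHS](big_cat_nat (n := N))//= lerDr sumr_ge0// => n _.
    by have /andP[a b] := rK n; rewrite mulr_ge0// ltW.
  rewrite -mulr_sumr mulrCA -[leRHS]mulr1 ler_wpM2l ?(ltW e3)//.
  rewrite big_mkord -opprB mulNr -subrX1 opprB.
  by have /andP[a b] := rK K; lra.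
rewrite (big_cat_nat (n := N))//= mulrDr.
have a4 : (1 - r) * `|\sum_(0 <= n < N) (D n - l) * r ^+ n| <= e / 3.
  apply: (@le_trans _ _ (e / 3 / (B + 1) * (B + 1))); last by rewrite divfK ?gt_eqF.
  by rewrite ler_pM//; lra.
have e33 : e / 3 + (e / 3 + e / 3) = e by lra.
apply: le_trans (ler_normD _ _) _; rewrite -[leRHS]e33.
apply: lerD => //; apply: le_trans (ler_normD _ _) _.
by rewrite !normrM [`|1 - r|]ger0_norm// lerD.
Qed.

Lemma is_derive_log_sum (R : realType) (x : R) K :
  is_derive x 1 (fun y : R => \sum_(0 <= n < K) n.+1%:R^-1 * y ^+ n.+1)
    (\sum_(0 <= n < K) x ^+ n).
Proof.
elim: K => [|K IH].
  rewrite (_ : (fun y : R => _) = cst 0); last by apply/funext => y; rewrite big_geq.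
  by rewrite big_geq//; exact: is_derive_cst.
rewrite (_ : (fun y : R => _) =
    (fun y : R => \sum_(0 <= n < K) n.+1%:R^-1 * y ^+ n.+1) +
    (fun y : R => K.+1%:R^-1 * y ^+ K.+1)); last first.
  by apply/funext => y; rewrite big_nat_recr.
rewrite big_nat_recr//=; apply: is_deriveD.
rewrite (_ : (fun y : R => _) = K.+1%:R^-1 *: (@id R) ^+ K.+1); last first.
  by apply/funext => y; rewrite /= exprfctE.
apply: is_derive_eq.
by rewrite /GRing.scale /= mulr1 mulKf// pnatr_eq0.
Qed.

(** The remainder [u] of the series has derivative [y ^ K / (1 - y)], which on
   [[0, r]] is nonnegative and bounded by its value [c] at [r]. *)
Lemma log_series (R : realType) (r : R) K : 0 <= r < 1 ->
  `|\sum_(0 <= n < K) n.+1%:R^-1 * r ^+ n.+1 + ln (1 - r)|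
    <= r ^+ K.+1 / (1 - r).
Proof.
move=> /andP[r0 r1].
pose S (y : R) := \sum_(0 <= n < K) n.+1%:R^-1 * y ^+ n.+1.
pose c := r ^+ K / (1 - r).
pose u (y : R) := - S y - ln (1 - y).
have du (y : R) : y < 1 -> is_derive y 1 u (y ^+ K / (1 - y)).
  move=> y1; have y1' : 0 < 1 - y by rewrite subr_gt0.
  have d1 := is_derive_log_sum y K.
  have d2 : is_derive y 1 (fun z : R => ln (1 - z)) ((1 - y)^-1 * -1).
    have d3 : is_derive y 1 (fun z : R => 1 - z) (-1).
      by rewrite -[-1]sub0r; exact: is_deriveB.
    have d4 : is_derive (1 - y) 1 (@ln R) (1 - y)^-1 by exact: is_derive1_ln.
    exact: (@is_derive1_comp _ (@ln R) (fun z => 1 - z)).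
  apply: is_derive_eq.
  rewrite mulrN1 opprK big_mkord.
  apply: (mulIf (lt0r_neq0 y1')); rewrite divfK ?gt_eqF// mulrDl mulVf ?gt_eqF//.
  rewrite mulNr -mulrN opprB mulrC -subrX1; ring.
have u0 : u 0 = 0.
  rewrite /u /S subr0 ln1 subr0 big1 ?oppr0// => n _.
  by rewrite expr0n mulr0.
have nn (y : R) : 0 <= y <= r -> 0 <= y ^+ K / (1 - y) <= c.
  move=> /andP[y0 yr]; have y1' : 0 < 1 - y by lra.
  have r1' : 0 < 1 - r by lra.
  rewrite divr_ge0 ?exprn_ge0 ?(ltW y1')//= /c ler_pM ?exprn_ge0 ?invr_ge0 ?(ltW y1')//.
    by rewrite lerXn2r ?nnegrE.
  by rewrite lef_pV2 ?posrE//; lra.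
have cu (v : R -> R) (dv : R -> R) :
    (forall y : R, y < 1 -> is_derive y 1 v (dv y)) -> {within `[0, r], continuous v}.
  move=> dvv; apply: derivable_within_continuous => y; rewrite in_itv/= => /andP[_ yr].
  by have [] := dvv y (le_lt_trans yr r1).
have up : 0 <= u r.
  rewrite -u0; apply: (@ger0_derive1_ndecr _ u 0 r) => //.
  - move=> y; rewrite in_itv/= => /andP[_ yr].
    by have [] := du y (lt_trans yr r1).
  - move=> y; rewrite in_itv/= => /andP[y0 yr].
    have dy := du y (lt_trans yr r1); rewrite derive1E derive_val.
    by have /andP[] // : 0 <= y ^+ K / (1 - y) <= c; apply: nn; rewrite !ltW.
  - exact: cu du.
have dv (y : R) : y < 1 -> is_derive y 1 (fun z => c * z - u z) (c - y ^+ K / (1 - y)).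
  move=> y1; have dy := du y y1.
  rewrite (_ : (fun z => _) = (c *: id) - u); last by apply/funext.
  apply: is_derive_eq; by rewrite /GRing.scale /= mulr1.
have low : u r <= c * r.
  pose v z := c * z - u z; suff : v 0 <= v r by rewrite /v u0 mulr0; lra.
  apply: (@ger0_derive1_ndecr _ v 0 r); last 4 first.
  - exact: cu dv.
  - exact: lexx.
  - exact: r0.
  - exact: lexx.
  - move=> y; rewrite in_itv/= => /andP[_ yr].
    by have [] := dv y (lt_trans yr r1).
  - move=> y; rewrite in_itv/= => /andP[y0 yr].
    have dy := dv y (lt_trans yr r1); rewrite derive1E (@derive_val _ _ _ _ _ _ _ dy).
    rewrite subr_ge0.
    by have /andP[] // : 0 <= y ^+ K / (1 - y) <= c; apply: nn; rewrite !ltW.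
rewrite -/(S r) -normrN opprD -/(u r) ger0_norm//.
by apply: le_trans low _; rewrite /c exprSr mulrAC.
Qed.

Lemma powR_natr_cvg0 (R : realType) (d : R) (f : nat -> nat) : 0 < d ->
  (forall n, (n <= f n)%N) -> ((f n).+1%:R `^ (- d) : R) @[n --> \oo] --> (0 : R).
Proof.
move=> d0 fn.
have : (d * ln (f n).+1%:R : R) @[n --> \oo] --> +oo.
  apply/cvgryPge => A.
  have lnA : \forall n \near \oo, A / d <= ln n%:R :> R.
    by move/cvgryPge : (@cvgn_ln_natr R); exact.
  near=> n.
  rewrite mulrC -ler_pdivrMr//.
  apply: (@le_trans _ _ (ln n%:R)); last by rewrite ler_ln_natr// (leq_trans (fn n)).
  by near: n; exact: lnA.
move=> h; have := cvg_comp _ _ h (@cvgr_expR R).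
rewrite (_ : _ \o _ = fun n => (f n).+1%:R `^ (- d))//.
by apply/funext => n /=; rewrite powR_natrE// mulNr.
Unshelve. all: by end_near. Qed.

(** The discounted dyadic sum is the logarithm of zeta(1 + d) up to errors
   [O(d)] and [O(d ln d)], and zeta(1 + d) is [1 / d + O(1)]. Taking [d = x ^ 2]
   makes all the errors [O(x)]. *)
Lemma log_euler_abel_sum (R : realType) (x : R) : 0 < x <= 1 ->
  let d := x ^+ 2 in let r := 2 `^ (- d) in
  \forall K \near \oo, `|\sum_(0 <= n < K)
    (log_euler R (2 ^ n.+1) - log_euler R (2 ^ n)) * r ^+ n.+1 + ln d| <= 28 * x.
Proof.
move=> /andP[x0 x1] /=; set d := x ^+ 2; set r := 2 `^ (- d).
have d0 : 0 < d by rewrite exprn_gt0.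
have dx : d <= x by rewrite /d expr2 ler_piMl// ltW.
have lx : - ln d * d <= 2 * x.
  have := @ln_ge_1subV R x x0; rewrite /d lnXn// mulr2n => h.
  have : - ln x * x <= 1.
    have : - ln x * x <= x^-1 * x by rewrite ler_wpM2r ?(ltW x0)//; lra.
    by rewrite mulVf ?gt_eqF.
  have x0' := ltW x0; rewrite -(ler_pM2r x0) => h2; lra.
near=> K.
have := @log_zeta_le R d d0 (2 ^ K).
have := @log_zeta_ge R d d0 (2 ^ K) (ltac:(by rewrite expn_gt0)).
have := @log_euler_discount R d (2 ^ K) d0.
have := @log_euler_dyadic R d K d0.
rewrite -/r.
set W := prime_sum _ _; set V := \sum_(0 <= n < K) _; set Z := prime_sum _ _.
move=> /andP[V1 V2']; have {V2'}V2 : V <= W by exact: V2'.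
rewrite ler_norml => /andP[Z1 Z2] zl zu.
have zu' : Z <= d - ln d.
  apply: le_trans zu _; rewrite (_ : 1 + d^-1 = (1 + d) / d); last first.
    by rewrite mulrDl divff ?gt_eqF// mul1r addrC.
  rewrite ln_div ?posrE ?addr_gt0// lerB// le_ln1Dx//; lra.
have zl' : - d - ln d <= Z.
  apply: le_trans zl; rewrite -[X in X - _](expRK (- d)) -ln_div ?posrE ?expR_gt0//.
  have h : (2 ^ K).+1%:R `^ (- d) <= 1 - expR (- d).
    near: K; apply: (cvgr_le _ (@powR_natr_cvg0 R d (fun K => 2 ^ K)%N d0 _)).
      by move=> n; apply: ltnW; apply: ltn_expl.
    by rewrite subr_gt0 expR_lt1 oppr_lt0.
  rewrite ler_ln ?posrE ?divr_gt0 ?expR_gt0//; last first.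
    by apply: lt_le_trans (expR_gt0 (- d)) _; lra.
  by rewrite ler_wpM2r ?invr_ge0 ?(ltW d0)//; lra.
have W0 : 0 <= W.
  apply: prime_sum_ge0 => p pp; rewrite mulr_ge0 ?powR_ge0//.
  have := @log_euler_factor_bounds R p%:R^-1.
  rewrite invr_ge0 ler0n prime_inv_le_half// => /(_ isT) /andP[+ _].
  by apply: le_trans; rewrite invr_ge0.
have rd : 1 - r <= d.
  have [_ h] := @powR_opp_bounds R d 2 (ltW d0) isT; apply: le_trans h _.
  by rewrite -[leRHS]mulr1 ler_wpM2l ?(ltW d0)// ln2_le1.
have r1 : 0 <= 1 - r.
  by rewrite subr_ge0; have [/andP[_ h] _] := @powR_opp_bounds R d 2 (ltW d0) isT.
have rW : (1 - r) * W <= d * (13 * d - ln d) by rewrite ler_pM//; lra.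
have dd : d * d <= x.
  by rewrite (le_trans _ dx)// ler_piMl ?(ltW d0)//; exact: le_trans dx x1.
have hV : W - d * (13 * d - ln d) <= V.
  by apply: le_trans V1; move: rW; rewrite mulrBl mul1r; set y := d * _; lra.
have hd : d * (13 * d - ln d) <= 15 * x.
  have -> : d * (13 * d - ln d) = 13 * (d * d) + - ln d * d by ring.
  by move: dd lx; set y := d * d; set z := - ln d * d; lra.
rewrite ler_norml; move: hV hd V2 zu' zl' Z1 Z2 dx.
set y := d * _; set z := ln d => hV hd V2' zu' zl' Z1' Z2' dx'.
by apply/andP; split; lra.
Unshelve. all: by end_near. Qed.

Lemma ln_1sub_powR2 (R : realType) (d : R) : 0 < d ->
  `|ln (1 - 2 `^ (- d)) - ln d - ln (ln 2)| <= d.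
Proof.
move=> d0; have l2 : 0 < ln 2 :> R by rewrite ln_gt0//; lra.
have l21 := ln2_le1 R.
set a := d * ln 2; have a0 : 0 < a by rewrite mulr_gt0.
have ad : a <= d by rewrite /a; nra.
have -> : 2 `^ (- d) = (expR a)^-1 :> R.
  by rewrite powR_natrE// -expRN mulNr.
have ea := expR_ge1Dx a; have eN := expR_ge1Dx (- a); rewrite expRN in eN.
have e1 : 1 - (expR a)^-1 <= a by lra.
have e2 : a / (1 + a) <= 1 - (expR a)^-1.
  have : (expR a)^-1 <= (1 + a)^-1 by rewrite lef_pV2 ?posrE ?expR_gt0//; lra.
  have -> : a / (1 + a) = 1 - (1 + a)^-1 by field; rewrite gt_eqF//; lra.
  lra.
have e0 : 0 < a / (1 + a) by rewrite divr_gt0//; lra.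
have lna : ln a = ln d + ln (ln 2) by rewrite lnM ?posrE.
have b1 : ln (1 - (expR a)^-1) <= ln a.
  by rewrite ler_ln ?posrE// (lt_le_trans e0).
have b2 : ln a - a <= ln (1 - (expR a)^-1).
  apply: (@le_trans _ _ (ln (a / (1 + a)))); last first.
    by rewrite ler_ln ?posrE// (lt_le_trans e0).
  rewrite ln_div ?posrE//; last by lra.
  by rewrite lerB// le_ln1Dx//; lra.
rewrite ler_norml; apply/andP; split; lra.
Qed.

(** The constant is identified by comparing, through Abel's theorem, the dyadic
   values of [log_euler] with the harmonic numbers: the increments of the former
   generate the logarithm of zeta(1 + d), those of the latter
   [- ln (1 - 2 ^ (- d))], and both are [- ln d + O(1)] with known constants. *)
Lemma mertens3 (R : realType) :
  log_euler R n - ln (ln n%:R) @[n --> \oo] --> euler_gamma R.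
Proof.
have [k Lk] := log_euler_cvg R.
suff -> : euler_gamma R = k by [].
pose H n : R := \sum_(1 <= j < n.+1) j%:R^-1.
pose D n : R := log_euler R (2 ^ n) - H n.
have Hg : H n - ln n%:R @[n --> \oo] --> euler_gamma R by exact: is_cvg_euler_gamma.
pose l : R := k + ln (ln 2) - euler_gamma R.
have D0 : D 0%N = 0.
  by rewrite /D /H /log_euler prime_sumS prime_sum0 big_geq//= addr0 subr0.
have l2 : 0 < ln 2 :> R by rewrite ln_gt0//; lra.
have Dl : D n @[n --> \oo] --> l.
  have expn_cvg : (2 ^ n)%N @[n --> \oo] --> \oo.
    by apply: cvg_nat_ge => n; apply: ltnW; apply: ltn_expl.
  have Lk2 := cvg_comp _ _ expn_cvg Lk.
  apply: (@cvg_trans _ ((log_euler R (2 ^ n) - ln (ln (2 ^ n)%:R)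
      + ln (ln 2) - (H n - ln n%:R)) @[n --> \oo])); last first.
    by apply: cvgB => //; apply: cvgD; [exact: Lk2|exact: cvg_cst].
  apply: near_eq_cvg; near=> n.
  have n0 : (0 < n)%N by near: n; exact: nbhs_infty_gt.
  rewrite /D natrX lnXn// -[_ *+ n]mulr_natl lnM ?posrE ?ltr0n//; ring.
apply/eqP; rewrite -subr_eq0 -normr_le0; apply/ler_addgt0Pl => e e0.
rewrite addr0.
have e4 : 0 < e / 4 by rewrite divr_gt0.
have [eta eta0 Heta] := abel_theorem D0 Dl e4.
pose x : R := Num.min 1 (Num.min eta (e / 4 / 28)).
have x0 : 0 < x by rewrite !lt_min ltr01 eta0 divr_gt0.
have x1 : x <= 1 by rewrite ge_min lexx.
have xeta : x <= eta by rewrite !ge_min lexx orbT.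
have xe : 28 * x <= e / 4.
  by rewrite mulrC -ler_pdivlMr// !ge_min lexx !orbT.
set d := x ^+ 2; set r := 2 `^ (- d) : R.
have d0 : 0 < d by rewrite exprn_gt0.
have dx : d <= x by rewrite /d expr2 ler_piMl// ltW.
have [/andP[r0 _] r1] := @powR_opp_bounds R d 2 (ltW d0) isT.
have rd : 1 - r <= d.
  by apply: le_trans r1 _; rewrite -[leRHS]mulr1 ler_wpM2l ?(ltW d0)// ln2_le1.
have r01 : 0 < r < 1.
  rewrite /r powR_natrE// expR_gt0 expR_lt1 mulNr oppr_lt0 mulr_gt0//.
have r1' : 0 < 1 - r by case/andP : r01 => _; rewrite subr_gt0.
have x01 : 0 < x <= 1 by rewrite x0.
have NA := Heta r r01 (le_trans rd (le_trans dx xeta)).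
have NB := log_euler_abel_sum x01.
have NC : \forall K \near \oo, r ^+ K.+1 / (1 - r) <= e / 4.
  have h : r ^+ K.+1 / (1 - r) @[K --> \oo] --> (0 : R).
    rewrite -[X in _ --> X](mul0r (1 - r)^-1); apply: cvgMl.
    rewrite (@cvg_shiftS _ (fun K => r ^+ K)); apply: cvg_expr.
    by case/andP : r01 => r0' ?; rewrite ger0_norm// ltW.
  exact: cvgr_le _ h _ e4.
have [K [A1 [B1 C1]]] : exists K,
   `|\sum_(0 <= n < K) (D n.+1 - D n) * r ^+ n.+1 - l| <= e / 4 /\
   `|\sum_(0 <= n < K) (log_euler R (2 ^ n.+1) - log_euler R (2 ^ n)) * r ^+ n.+1
     + ln d| <= 28 * x /\ r ^+ K.+1 / (1 - r) <= e / 4.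
  apply: (@filter_ex _ \oo); near=> K; split; [|split].
  - by near: K; exact: NA.
  - by near: K; exact: NB.
  - by near: K; exact: NC.
have r01' : 0 <= r < 1 by case/andP : r01 => /ltW -> ->.
have E1 := le_trans (log_series K r01') C1.
have F1 := ln_1sub_powR2 d0; rewrite -/r in F1.
have E : \sum_(0 <= n < K) (D n.+1 - D n) * r ^+ n.+1 =
   \sum_(0 <= n < K) (log_euler R (2 ^ n.+1) - log_euler R (2 ^ n)) * r ^+ n.+1
   - \sum_(0 <= n < K) n.+1%:R^-1 * r ^+ n.+1.
  rewrite -sumrB; apply: eq_bigr => n _.
  have HS : H n.+1 = H n + n.+1%:R^-1 by rewrite /H big_nat_recr.
  by rewrite /D HS -mulrBl; congr (_ * _); ring.
rewrite E /l in A1.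
move: A1 B1 E1 F1 xe dx; set a := \sum_(0 <= n < K) _; set b := \sum_(0 <= n < K) _.
rewrite !ler_norml => /andP[a1 a2] /andP[b1 b2] /andP[c1 c2] /andP[f1 f2] xe dx.
apply/andP; split; lra.
Unshelve. all: by end_near. Qed.

(** * Primes in windows of powers *)

Definition floor_pow (R : realType) (y : nat) (u : R) : nat :=
  Num.truncn (y%:R `^ u).

Lemma leq_floor_pow (R : realType) n y (u : R) :
  (n <= floor_pow y u)%N = (n%:R <= y%:R `^ u).
Proof. by rewrite /floor_pow truncn_ge_nat// powR_ge0. Qed.

Lemma floor_pow1 (R : realType) y : floor_pow y (1 : R) = y.
Proof. by rewrite /floor_pow powRr1// natrK. Qed.

Lemma floor_pow_homo (R : realType) y (u v : R) : (0 < y)%N -> u <= v ->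
  (floor_pow y u <= floor_pow y v)%N.
Proof. by move=> y0 uv; apply: le_truncn; apply: ler_powR => //; rewrite ler1n. Qed.

Lemma ln_floor_pow_bounds (R : realType) y (a : R) : (0 < y)%N -> 0 <= a ->
  a * ln y%:R - ln 2 <= ln (floor_pow y a)%:R <= a * ln y%:R.
Proof.
move=> y0 a0; have x0 : 0 < y%:R `^ a :> R by rewrite powR_gt0// ltr0n.
have k0 : (0 < floor_pow y a)%N.
  rewrite leq_floor_pow powR_natrE//; apply: le_trans (expR_ge1Dx _).
  by rewrite lerDl mulr_ge0// ln_natr_ge0.
have k0R : 0 < (floor_pow y a)%:R :> R by rewrite ltr0n.
have /andP[h1 h2] := truncn_itv (ltW x0); rewrite -/(floor_pow y a) in h1 h2.
rewrite -ln_powR; apply/andP; split; last by rewrite ler_ln ?posrE.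
rewrite lerBlDr -lnM ?posrE// ler_ln ?posrE ?mulr_gt0//.
apply: le_trans (ltW h2) _; rewrite -natr1.
have : 1 <= (floor_pow y a)%:R :> R by rewrite ler1n.
by lra.
Qed.

Lemma cvgn_floor_pow (R : realType) (a : R) : 0 < a ->
  floor_pow y a @[y --> \oo] --> \oo.
Proof.
move=> a0 A [N _ NA].
have lnA : \forall n \near \oo, N%:R / a <= ln n%:R :> R.
  by move/cvgryPge : (@cvgn_ln_natr R); exact.
change (\forall y \near \oo, A (floor_pow y a)); near=> y.
suff : (N <= floor_pow y a)%N by exact: (NA (floor_pow y a)).
rewrite leq_floor_pow.
have y0 : (0 < y)%N by near: y; exact: nbhs_infty_gt.
rewrite powR_natrE//; apply: le_trans (expR_ge1Dx _).
apply: (@le_trans _ _ (a * ln y%:R)); last by rewrite lerDr.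
by rewrite mulrC -ler_pdivrMr//; near: y; exact: lnA.
Unshelve. all: by end_near. Qed.

Lemma lnln_floor_pow (R : realType) (a : R) : 0 < a ->
  ln (ln (floor_pow y a)%:R) - ln (ln y%:R) @[y --> \oo] --> ln a.
Proof.
move=> a0.
have ratio : ln (floor_pow y a)%:R / ln y%:R @[y --> \oo] --> a.
  apply: (@squeeze_cvgr _ _ _ R (fun y => a - ln 2 * (ln y%:R)^-1)
    (fun=> a) (fun y => ln (floor_pow y a)%:R / ln y%:R)).
  - near=> y; have y1 : (1 < y)%N by near: y; exact: nbhs_infty_gt.
    have l0 := @ln_natr_gt0 R y y1.
    have /andP[h1 h2] := ln_floor_pow_bounds (ltnW y1) (ltW a0).
    rewrite ler_pdivlMr// ler_pdivrMr// h2 andbT.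
    by rewrite mulrBl mulfVK ?gt_eqF.
  - have h : (ln n%:R)^-1 @[n --> \oo] --> (0 : R).
      by apply: cvgy_inv; exact: cvgn_ln_natr.
    rewrite -[X in _ --> X]subr0 -[X in _ --> _ - X](mulr0 (ln 2)).
    by apply: cvgB; [exact: cvg_cst|exact: cvgMr].
  - exact: cvg_cst.
have := cvg_comp _ _ ratio (continuous_ln a0).
apply: cvg_trans; apply: near_eq_cvg; near=> y => /=.
rewrite ln_div ?posrE//; last first.
  by rewrite ln_natr_gt0//; near: y; exact: nbhs_infty_gt.
rewrite ln_natr_gt0//; near: y; apply: (@cvgn_floor_pow R a a0 [set n | (1 < n)%N]).
exact: nbhs_infty_gt.
Unshelve. all: by end_near. Qed.

(** The primes up to [y ^ a] contribute [ln (ln y) + ln a + c + o(1)], where the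
   constant [c] of Mertens' second theorem cancels out. *)
Lemma prime_recip_window (R : realType) (a b : R) : 0 < a -> 0 < b ->
  prime_sum (fun p => p%:R^-1) (floor_pow y b)
    - prime_sum (fun p => p%:R^-1) (floor_pow y a) @[y --> \oo] --> ln b - ln a.
Proof.
move=> a0 b0; have [c Mc] := mertens2 R.
have Ma := cvg_comp _ _ (cvgn_floor_pow a0) Mc.
have Mb := cvg_comp _ _ (cvgn_floor_pow b0) Mc.
have -> : ln b - ln a = (c + ln b) - (c + ln a) by ring.
pose M n : R := prime_sum (fun p => p%:R^-1) n.
rewrite (_ : (fun y => _) = fun y =>
  ((M (floor_pow y b) - ln (ln (floor_pow y b)%:R))
     + (ln (ln (floor_pow y b)%:R) - ln (ln y%:R)))
  - ((M (floor_pow y a) - ln (ln (floor_pow y a)%:R))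
     + (ln (ln (floor_pow y a)%:R) - ln (ln y%:R)))); last first.
  by apply/funext => y; rewrite -!/(M _); ring.
apply: cvgB; apply: cvgD.
- exact: Mb.
- exact: lnln_floor_pow.
- exact: Ma.
- exact: lnln_floor_pow.
Qed.

(** * Reciprocals of rough numbers *)

(** Since [pdiv 1 = 1], the number 1, which has no prime factor, is a separate
   case. *)
Definition rough (y m : nat) : bool := (m == 1)%N || (y <= pdiv m)%N.

Definition rough_sum (R : realType) (X y : nat) : R :=
  \sum_(1 <= m < X.+1 | rough y m) m%:R^-1.

Lemma rough_sum_homo (R : realType) X X' y : (X <= X')%N ->
  rough_sum R X y <= rough_sum R X' y.
Proof.
move=> XX; rewrite /rough_sum [leRHS](big_cat_nat (n := X.+1))//= lerDl.
by rewrite sumr_ge0// => m _; rewrite invr_ge0.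
Qed.

Lemma rough_sum_ge1 (R : realType) X y : (0 < X)%N -> 1 <= rough_sum R X y.
Proof.
move=> X0; rewrite /rough_sum big_mkcond big_ltn//= invr1 lerDl.
by apply: sumr_ge0 => m _; case: ifP => // _; rewrite invr_ge0.
Qed.

Lemma rough_sum_small (R : realType) X y : (0 < X)%N -> (X < y)%N ->
  rough_sum R X y = 1.
Proof.
move=> X0 Xy; rewrite /rough_sum big_mkcond big_ltn//= invr1.
rewrite big_nat_cond big1 ?addr0// => m /andP[/andP[m1 mX] _].
rewrite /rough gtn_eqF//= ifF//; apply/negbTE; rewrite -ltnNge.
apply: leq_ltn_trans Xy; apply: leq_trans (pdiv_leq (ltnW m1)) _.
by rewrite -ltnS.
Qed.

Lemma rough_mul p m : prime p -> (0 < m)%N -> (pdiv (p * m) == p) = rough p m.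
Proof.
move=> pp m0; have p1 := prime_gt1 pp.
have pm1 : (1 < p * m)%N by rewrite (leq_trans p1)// leq_pmulr.
have h : (pdiv (p * m) <= p)%N by rewrite pdiv_min_dvd// dvdn_mulr.
rewrite /rough; apply/eqP/orP => [E|].
  have [->|m1] := eqVneq m 1%N; [by left|right].
  have m1' : (1 < m)%N by rewrite ltn_neqAle eq_sym m1.
  rewrite -{1}E pdiv_min_dvd ?prime_gt1 ?pdiv_prime//.
  by rewrite dvdn_mull// pdiv_dvd.
move=> H; apply/eqP; rewrite eqn_leq h /=.
have := pdiv_dvd (p * m); rewrite Euclid_dvdM ?pdiv_prime//.
move=> /orP[|]; first by rewrite dvdn_prime2 ?pdiv_prime// => /eqP ->.
case: H => [/eqP m1|pm dm].
  by rewrite {2}m1 dvdn1 => /eqP E; move: (pdiv_prime pm1); rewrite E.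
apply: leq_trans pm _; rewrite pdiv_min_dvd// prime_gt1// pdiv_prime//.
Qed.

Lemma sum_multiples (R : realType) (F : nat -> R) p X : (0 < p)%N ->
  (forall n, ~~ (p %| n)%N -> F n = 0) ->
  \sum_(0 <= n < X.+1) F n = \sum_(0 <= m < (X %/ p).+1) F (p * m)%N.
Proof.
move=> p0 F0; elim: X => [|X IH]; first by rewrite div0n !big_nat1 muln0.
rewrite big_nat_recr//= IH divnS//; case: (boolP (p %| X.+1)%N) => pX; last first.
  by rewrite F0// addr0 add0n.
rewrite add1n [RHS]big_nat_recr//=; congr (_ + F _).
by rewrite -(divnK pX) divnS// pX add1n mulnC.
Qed.

Lemma sum_pdiv_eq (R : realType) X p : prime p ->
  \sum_(2 <= n < X.+1 | pdiv n == p) n%:R^-1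
    = p%:R^-1 * rough_sum R (X %/ p) p.
Proof.
move=> pp; have p0 := prime_gt0 pp; rewrite /rough_sum mulr_sumr.
pose F n : R := if (1 < n)%N && (pdiv n == p) then n%:R^-1 else 0.
have -> : \sum_(2 <= n < X.+1 | pdiv n == p) n%:R^-1 = \sum_(0 <= n < X.+1) F n.
  rewrite [LHS]big_mkcond /=; case: X => [|X].
    by rewrite big_geq// big_nat1.
  rewrite [RHS](big_cat_nat (n := 2))//= [X in X + _]big_nat_recr//= big_nat1.
  rewrite {1 2}/F /= !add0r big_nat [RHS]big_nat.
  by apply: eq_bigr => n /andP[n1 _]; rewrite /F n1.
rewrite (@sum_multiples _ _ p)//; last first.
  move=> n; rewrite /F; case: ifPn => // /andP[n1 /eqP <-].
  by rewrite pdiv_dvd.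
rewrite big_ltn// muln0 {1}/F /= add0r [RHS]big_mkcond /=.
rewrite big_nat [RHS]big_nat; apply: eq_bigr => m /andP[m0 _].
rewrite /F rough_mul// (leq_trans (prime_gt1 pp)) ?leq_pmulr//=.
by rewrite natrM invfM.
Qed.

(** Buchstab's identity: sort the rough numbers other than 1 by their least
   prime factor. *)
Lemma rough_sum_buchstab (R : realType) X y : (1 < y)%N -> (0 < X)%N ->
  rough_sum R X y = 1 +
    \sum_(y <= p < X.+1 | prime p) p%:R^-1 * rough_sum R (X %/ p) p.
Proof.
move=> y1 X0.
transitivity (1 + \sum_(2 <= n < X.+1)
    \sum_(y <= p < X.+1 | prime p && (pdiv n == p)) n%:R^-1 : R); last first.
  congr (1 + _); rewrite (exchange_big_dep prime)/=; last by move=> i j _ /andP[].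
  apply: eq_bigr => p pp; rewrite -sum_pdiv_eq//; apply: eq_bigl => n.
  by rewrite pp.
rewrite /rough_sum big_mkcond big_ltn//= invr1; congr (1 + _).
rewrite big_nat [RHS]big_nat; apply: eq_bigr => n /andP[n1 nX].
have pn : prime (pdiv n) by exact: pdiv_prime.
rewrite /rough gtn_eqF//=; case: ifPn => yn; last first.
  rewrite big_nat_cond big1// => p /andP[/andP[yp _] /andP[_ /eqP np]].
  by rewrite np yp in yn.
have nX' : (pdiv n < X.+1)%N.
  by apply: leq_ltn_trans nX; rewrite pdiv_leq// ltnW.
rewrite (big_cat_nat (n := pdiv n))//= ?(ltnW nX')//.
rewrite big_nat_cond big1 ?add0r; last first.
  move=> p /andP[/andP[_ pn'] /andP[_ /eqP np]].
  by rewrite np ltnn in pn'.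
rewrite big_mkcond big_ltn// pn eqxx /= big_nat_cond big1 ?addr0//.
move=> p /andP[/andP[np _] _]; case: ifP => // /andP[_ /eqP np'].
by rewrite np' ltnn in np.
Qed.

(** * The limit function *)

(** If [p = y ^ t] then [y ^ u / p = p ^ (u / t - 1)]: one inequality for
   [t >= a], the other one for [t <= b]. *)
Lemma floor_pow_div_le (R : realType) y p (a u : R) : 0 < a -> 0 < u ->
  (0 < p)%N -> y%:R `^ a <= p%:R ->
  (floor_pow y u %/ p <= floor_pow p (u / a - 1))%N.
Proof.
move=> a0 u0 p0 yp; have p0R : 0 < p%:R :> R by rewrite ltr0n.
have v0 : 0 < u / a by rewrite divr_gt0.
rewrite leq_floor_pow -(ler_pM2l p0R) mulr_powRB1 ?(ltW p0R)//.
apply: (@le_trans _ _ (y%:R `^ u)).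
  by rewrite -natrM -leq_floor_pow mulnC leq_trunc_div.
have -> : u = a * (u / a) by rewrite mulrCA divff ?gt_eqF// mulr1.
rewrite [X in _ <= _ `^ X](_ : _ = u / a); last by rewrite mulrAC divff ?gt_eqF// mul1r.
by rewrite (powRrM y%:R) ge0_ler_powR ?nnegrE ?powR_ge0 ?(ltW v0) ?(ltW p0R).
Qed.

Lemma floor_pow_div_ge (R : realType) y p (b u : R) : 0 < b -> 0 < u ->
  (0 < p)%N -> p%:R <= y%:R `^ b ->
  (floor_pow p (u / b - 1) <= floor_pow y u %/ p)%N.
Proof.
move=> b0 u0 p0 yp; have p0R : 0 < p%:R :> R by rewrite ltr0n.
have v0 : 0 < u / b by rewrite divr_gt0.
rewrite leq_divRL// leq_floor_pow natrM mulrC.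
apply: (@le_trans _ _ (p%:R `^ (u / b))).
  rewrite -mulr_powRB1 ?(ltW p0R)// ler_pM2l//.
  by rewrite -leq_floor_pow.
rewrite [in leRHS](_ : u = b * (u / b)); last first.
  by rewrite mulrCA divff ?gt_eqF// mulr1.
by rewrite (powRrM y%:R) ge0_ler_powR ?nnegrE ?powR_ge0 ?(ltW v0) ?(ltW p0R).
Qed.

Section buchstab_limit.
Variables (R : realType) (w : R -> R).
Hypothesis hw : is_buchstab w.

(** The limit of the sums over rough numbers up to [y ^ u]. The equation of [w]
   says that its derivative at [u > 1] is its value at [u - 1] divided by [u]. *)
Definition buchstab_shift (u : R) : R := (u + 1) * w (u + 1).

Local Notation g := buchstab_shift.

Lemma buchstab_shift_small u : 0 <= u <= 1 -> g u = 1.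
Proof.
move=> /andP[u0 u1]; have [_ w1 _] := hw.
rewrite /g w1; last by apply/andP; split; lra.
by rewrite mulfV//; apply: lt0r_neq0; lra.
Qed.

Let g_derive (x : R) : 1 < x -> is_derive x 1 g (g (x - 1) / x).
Proof.
move=> x1; have [_ _ w2] := hw.
have d1 : is_derive (x + 1) 1 (fun t => t * w t) (g (x - 1) / x).
  have -> : g (x - 1) / x = w (x + 1 - 1).
    rewrite /g subrK addrK mulrAC divff ?mul1r//; apply: lt0r_neq0; lra.
  by apply: w2; lra.
have d2 : is_derive x 1 (fun t : R => t + 1) 1.
  by rewrite -[X in is_derive _ _ _ X]addr0; exact: is_deriveD.
rewrite -[X in is_derive _ _ _ X]mulr1.
exact: (@is_derive1_comp _ (fun t => t * w t) (fun t : R => t + 1)).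
Qed.

Let g_continuous (a b : R) : 1 <= a -> {within `[a, b], continuous g}.
Proof.
move=> a1; apply: continuous_in_subspaceT => x; rewrite inE/= in_itv/= => /andP[ax _].
have [cw _ _] := hw.
have wx : {for x + 1, continuous w}.
  have /continuous_within_itvcyP[cw1 _] := cw.
  by apply: cw1; rewrite in_itv/= andbT; lra.
have c1 : {for x, continuous (fun t : R => t + 1)}.
  by apply: cvgD; [exact: cvg_id|exact: cvg_cst].
apply: cvgM; first exact: c1.
exact: (@continuous_comp _ _ _ (fun t : R => t + 1) w x c1 wx).
Qed.

(** The mean value theorem in the variable [ln v], for which the derivative of
   [g] is [g (v - 1)]. *)
Lemma buchstab_shift_mvt (v' v K1 K2 : R) : 1 <= v' -> v' <= v ->
  (forall x, v' <= x <= v -> K1 <= g (x - 1) <= K2) ->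
  K1 * (ln v - ln v') <= g v - g v' <= K2 * (ln v - ln v').
Proof.
move=> v1 vv K12.
have dK (K x : R) : 1 < x ->
    is_derive x 1 (fun t => K * ln t - g t) ((K - g (x - 1)) / x).
  move=> x1; have d1 := g_derive x1.
  have d2 : is_derive x 1 (@ln R) x^-1 by apply: is_derive1_ln; lra.
  rewrite (_ : (fun t => _) = (K *: @ln R) - g); last by apply/funext.
  by apply: is_derive_eq; rewrite /GRing.scale /= mulrBl.
have cK K : {within `[v', v], continuous (fun t => K * ln t - g t)}.
  move=> x; apply: cvgB; last exact: (g_continuous v1).
  apply: cvgMr; move: x; apply: continuous_in_subspaceT => x.
  by rewrite inE/= in_itv/= => /andP[vx _]; apply: continuous_ln; lra.
have mono : K2 * ln v' - g v' <= K2 * ln v - g v.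
  apply: (@ger0_derive1_ndecr _ (fun t => K2 * ln t - g t) v' v) => //.
  - move=> x; rewrite in_itv/= => /andP[xv _].
    by have [] := dK K2 x (le_lt_trans v1 xv).
  - move=> x; rewrite in_itv/= => /andP[xv xv'].
    have d := dK K2 x (le_lt_trans v1 xv); rewrite derive1E derive_val.
    have /andP[_ h] : K1 <= g (x - 1) <= K2 by apply: K12; rewrite !ltW.
    by rewrite divr_ge0 ?subr_ge0//; lra.
have anti : K1 * ln v - g v <= K1 * ln v' - g v'.
  apply: (@ler0_derive1_nincr _ (fun t => K1 * ln t - g t) v' v) => //.
  - move=> x; rewrite in_itv/= => /andP[xv _].
    by have [] := dK K1 x (le_lt_trans v1 xv).
  - move=> x; rewrite in_itv/= => /andP[xv xv'].
    have d := dK K1 x (le_lt_trans v1 xv); rewrite derive1E derive_val.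
    have /andP[h _] : K1 <= g (x - 1) <= K2 by apply: K12; rewrite !ltW.
    by rewrite pmulr_lle0 ?invr_gt0 ?subr_le0//; lra.
rewrite !mulrBr; apply/andP; split; lra.
Qed.

End buchstab_limit.

(** * Reciprocals of rough numbers up to a power *)

Definition rough_window (R : realType) (X m n : nat) : R :=
  \sum_(m.+1 <= p < n.+1 | prime p) p%:R^-1 * rough_sum R (X %/ p) p.

Lemma rough_window_cat (R : realType) X m n k : (m <= n)%N -> (n <= k)%N ->
  rough_window R X m k = rough_window R X m n + rough_window R X n k.
Proof. by move=> mn nk; rewrite /rough_window (big_cat_nat (n := n.+1)). Qed.

Lemma rough_sum_floor_pow_small (R : realType) (u : R) : 0 <= u < 1 ->
  rough_sum R (floor_pow y u) y @[y --> \oo] --> (1 : R).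
Proof.
move=> /andP[u0 u1]; apply: cvg_near_cst; near=> y.
have y1 : (1 < y)%N by near: y; exact: nbhs_infty_gt.
have y0 : (0 < y)%N by apply: ltnW.
have l0 := @ln_natr_gt0 R y y1.
apply: rough_sum_small.
  rewrite leq_floor_pow powR_natrE//; apply: le_trans (expR_ge1Dx _).
  by rewrite lerDl mulr_ge0// ltW.
rewrite ltnNge leq_floor_pow -ltNge powR_natrE//.
rewrite -[ltRHS](lnK (x := y%:R)) ?posrE ?ltr0n// ltr_expR.
by rewrite -[ltRHS]mul1r ltr_pM2r.
Unshelve. all: by end_near. Qed.

Section window.
Variables (R : realType) (u a b A B : R).
Hypotheses (u0 : 0 < u) (a0 : 0 < a) (ab : a <= b).
Hypothesis limA :
  rough_sum R (floor_pow y (u / a - 1)) y @[y --> \oo] --> A.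
Hypothesis limB :
  rough_sum R (floor_pow y (u / b - 1)) y @[y --> \oo] --> B.

Let M n : R := prime_sum (fun p => p%:R^-1) n.

(** For [p] between [y ^ a] and [y ^ b], the number [y ^ u / p] is between
   [p ^ (u / b - 1)] and [p ^ (u / a - 1)]. *)
Lemma rough_window_bounds (e : R) : 0 < e -> \forall y \near \oo,
  (ln b - ln a) * B - e <=
    rough_window R (floor_pow y u) (floor_pow y a) (floor_pow y b)
  <= (ln b - ln a) * A + e.
Proof.
move=> e0; have b0 : 0 < b by apply: lt_le_trans ab.
pose h := ln b - ln a; have h0 : 0 <= h by rewrite subr_ge0 ler_ln ?posrE.
pose e' := e / 2 / (h + 1); have h1 : 0 < h + 1 by lra.
have e'0 : 0 < e' by rewrite !divr_gt0.
have he' : h * e' <= e / 2.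
  rewrite /e' mulrA ler_pdivrMr// mulrC ler_wpM2l//; lra.
have e2 : 0 < e / 2 by rewrite divr_gt0.
have nA := cvgr_distC_le _ _ limA _ e'0.
have nB := cvgr_distC_le _ _ limB _ e'0.
have [P _ HP] : \forall p \near \oo,
    rough_sum R (floor_pow p (u / a - 1)) p <= A + e' /\
    B - e' <= rough_sum R (floor_pow p (u / b - 1)) p.
  near=> p.
  have : `|rough_sum R (floor_pow p (u / a - 1)) p - A| <= e'.
    by near: p; exact: nA.
  have : `|rough_sum R (floor_pow p (u / b - 1)) p - B| <= e'.
    by near: p; exact: nB.
  by rewrite !ler_norml => /andP[? ?] /andP[? ?]; split; lra.
have W := prime_recip_window a0 b0; rewrite -/h in W.
have WA : (M (floor_pow y b) - M (floor_pow y a)) * (A + e') @[y --> \oo]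
    --> h * (A + e') by exact: cvgMl.
have WB : (M (floor_pow y b) - M (floor_pow y a)) * (B - e') @[y --> \oo]
    --> h * (B - e') by exact: cvgMl.
have nWA := cvgr_distC_le _ _ WA _ e2.
have nWB := cvgr_distC_le _ _ WB _ e2.
near=> y.
have y0 : (0 < y)%N by near: y; exact: nbhs_infty_gt.
have yab : (floor_pow y a <= floor_pow y b)%N by exact: floor_pow_homo.
have yP : (P <= floor_pow y a)%N.
  near: y; apply: (@cvgn_floor_pow R a a0 [set n | (P <= n)%N]).
  exact: nbhs_infty_ge.
have hA : `|(M (floor_pow y b) - M (floor_pow y a)) * (A + e')
    - h * (A + e')| <= e / 2 by near: y; exact: nWA.
have hB : `|(M (floor_pow y b) - M (floor_pow y a)) * (B - e')
    - h * (B - e')| <= e / 2 by near: y; exact: nWB.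
have ME : M (floor_pow y b) - M (floor_pow y a) =
    \sum_((floor_pow y a).+1 <= p < (floor_pow y b).+1 | prime p) p%:R^-1.
  by rewrite /M (prime_sum_split _ yab) addrAC subrr add0r.
rewrite -/h; move: hA hB; rewrite !ler_norml.
rewrite ME => /andP[_ hA] /andP[hB _]; apply/andP; split.
  apply: (@le_trans _ _ (\sum_((floor_pow y a).+1 <= p < (floor_pow y b).+1 | prime p)
     p%:R^-1 * (B - e'))); first by rewrite -mulr_suml; lra.
  rewrite /rough_window big_nat_cond [leRHS]big_nat_cond.
  apply: ler_sum => p /andP[/andP[yp py] pp]; have p0 := prime_gt0 pp.
  rewrite ler_wpM2l ?invr_ge0//.
  have [_ hp] := HP p (leq_trans yP (ltnW yp)).
  apply: le_trans hp _; apply: rough_sum_homo; apply: floor_pow_div_ge => //.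
  by rewrite -leq_floor_pow -ltnS.
apply: (@le_trans _ _ (\sum_((floor_pow y a).+1 <= p < (floor_pow y b).+1 | prime p)
   p%:R^-1 * (A + e'))); last by rewrite -mulr_suml; lra.
rewrite /rough_window big_nat_cond [leRHS]big_nat_cond.
apply: ler_sum => p /andP[/andP[yp py] pp]; have p0 := prime_gt0 pp.
rewrite ler_wpM2l ?invr_ge0//.
have [hp _] := HP p (leq_trans yP (ltnW yp)).
apply: le_trans hp; apply: rough_sum_homo; apply: floor_pow_div_le => //.
by rewrite ltW// ltNge -leq_floor_pow -ltnNge.
Unshelve. all: by end_near. Qed.

End window.

Section rough_limit.
Variables (R : realType) (w : R -> R).
Hypothesis hw : is_buchstab w.

Local Notation g := (buchstab_shift w).

Let cvg_below (x : R) := forall v, 0 <= v < x ->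
  rough_sum R (floor_pow y v) y @[y --> \oo] --> g v.

Let g_homo (x : R) : cvg_below x -> forall v v', 0 <= v -> v <= v' -> v' < x ->
  g v <= g v'.
Proof.
move=> H v v' v0 vv vx.
apply: ler_cvg_to (H v _) (H v' _) _.
- by rewrite v0 (le_lt_trans vv).
- by rewrite (le_trans v0).
near=> y; apply: rough_sum_homo; apply: floor_pow_homo => //.
near: y; exact: nbhs_infty_gt.
Unshelve. all: by end_near. Qed.

(* By the mean value theorem, [g (u / a) - g (u / b)] satisfies the same bounds
   as the window from [y ^ a] to [y ^ b]. The error is the difference of these
   bounds, which telescopes when [b / a] is kept constant. *)
Let window_error (x u a b e : R) : cvg_below x -> u - 1 < x ->
  1 <= a -> a <= b -> b <= u -> 0 < e -> \forall y \near \oo,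
  `|rough_window R (floor_pow y u) (floor_pow y a) (floor_pow y b)
     - (g (u / a) - g (u / b))|
    <= (ln b - ln a) * (g (u / a - 1) - g (u / b - 1)) + e.
Proof.
move=> H ux a1 ab bu e0.
have a0 : 0 < a by lra. have b0 : 0 < b by lra. have u0 : 0 < u by lra.
have ub1 : 1 <= u / b by rewrite ler_pdivlMr// mul1r.
have uab : u / b <= u / a by rewrite ler_pM2l// lef_pV2 ?posrE.
have uau : u / a <= u by rewrite ler_pdivrMr// ler_peMr// ltW.
have cA : rough_sum R (floor_pow y (u / a - 1)) y @[y --> \oo] --> g (u / a - 1).
  by apply: H; apply/andP; split; lra.
have cB : rough_sum R (floor_pow y (u / b - 1)) y @[y --> \oo] --> g (u / b - 1).
  by apply: H; apply/andP; split; lra.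
have mvt : g (u / b - 1) * (ln (u / a) - ln (u / b)) <= g (u / a) - g (u / b)
    <= g (u / a - 1) * (ln (u / a) - ln (u / b)).
  apply: (buchstab_shift_mvt hw) => // z /andP[z1 z2].
  by apply/andP; split; apply: (g_homo H); lra.
rewrite !ln_div ?posrE// in mvt.
have l : ln u - ln a - (ln u - ln b) = ln b - ln a by lra.
rewrite l in mvt.
have := rough_window_bounds u0 a0 ab cA cB e0.
case/andP: mvt => m1 m2; apply: filterS => y /andP[w1 w2].
by rewrite ler_norml mulrBr; apply/andP; split; lra.
Qed.

(* The subdivision [expR (i * h)], for [i <= k], of ratio [expR h]. *)
Let windows_error (x u h e : R) (k : nat) : cvg_below x -> u - 1 < x -> 0 <= h ->
  expR (k%:R * h) <= u -> 0 < e -> \forall y \near \oo,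
  `|rough_window R (floor_pow y u) y (floor_pow y (expR (k%:R * h)))
     - (g u - g (u / expR (k%:R * h)))|
    <= h * (g (u - 1) - g (u / expR (k%:R * h) - 1)) + e.
Proof.
move=> H ux h0; elim: k e => [|k IH] e ku e0.
  apply: nearW => y; rewrite mul0r expR0 divr1 !subrr floor_pow1 /rough_window.
  by rewrite big_geq// subrr normr0 mulr0 add0r ltW.
have kk : expR (k%:R * h) <= expR (k.+1%:R * h).
  by rewrite ler_expR ler_wpM2r// ler_nat.
have k1 : 1 <= expR (k%:R * h).
  by apply: le_trans (expR_ge1Dx _); rewrite lerDl mulr_ge0.
have e2 : 0 < e / 2 by rewrite divr_gt0.
have n1 := IH _ (le_trans kk ku) e2.
have n2 := window_error H ux k1 kk ku e2.
rewrite !expRK in n2.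
have hE : k.+1%:R * h - k%:R * h = h by rewrite -natr1; ring.
rewrite hE in n2.
near=> y; have y0 : (0 < y)%N by near: y; exact: nbhs_infty_gt.
rewrite (@rough_window_cat _ _ _ (floor_pow y (expR (k%:R * h)))); last first.
- exact: floor_pow_homo.
- by rewrite -{1}(floor_pow1 R y); exact: floor_pow_homo.
have m1 : `|rough_window R (floor_pow y u) y (floor_pow y (expR (k%:R * h)))
     - (g u - g (u / expR (k%:R * h)))|
    <= h * (g (u - 1) - g (u / expR (k%:R * h) - 1)) + e / 2.
  by near: y; exact: n1.
have m2 : `|rough_window R (floor_pow y u) (floor_pow y (expR (k%:R * h)))
       (floor_pow y (expR (k.+1%:R * h)))
     - (g (u / expR (k%:R * h)) - g (u / expR (k.+1%:R * h)))|
    <= h * (g (u / expR (k%:R * h) - 1) - g (u / expR (k.+1%:R * h) - 1)) + e / 2.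
  by near: y; exact: n2.
move: m1 m2; rewrite !ler_norml !mulrBr => /andP[? ?] /andP[? ?].
by apply/andP; split; lra.
Unshelve. all: by end_near. Qed.

(* Buchstab's identity at [u] only involves exponents up to [u - 1]. For a
   subdivision into [k] steps, the total error [ln u / k * (g (u - 1) - g 0)]
   tends to 0 with [1 / k]. *)
Let rough_limit_step (x u : R) : 1 <= u -> u - 1 < x -> cvg_below x ->
  rough_sum R (floor_pow y u) y @[y --> \oo] --> g u.
Proof.
move=> u1 ux H; have u0 : 0 < u by lra.
apply/cvgrPdist_le => e e0.
have lu : 0 <= ln u by exact: ln_ge0.
pose G := g (u - 1) - 1.
have G0 : 0 <= G.
  have g1 : g 0 = 1 by rewrite (buchstab_shift_small hw) ?lexx ?ler01.
  have : g 0 <= g (u - 1) by apply: (g_homo H); lra.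
  by rewrite g1 subr_ge0.
pose k := (Num.truncn (ln u * G / (e / 3))).+1.
have e3 : 0 < e / 3 by rewrite divr_gt0.
have k0 : 0 < k%:R :> R by rewrite ltr0n.
pose h := ln u / k%:R; have h0 : 0 <= h by rewrite divr_ge0// ltW.
have hG : h * G <= e / 3.
  rewrite /h mulrAC ler_pdivrMr// (mulrC (e / 3)) -ler_pdivrMr//.
  by apply: ltW; exact: truncnS_gt.
have ku : expR (k%:R * h) = u.
  by rewrite /h mulrCA divff ?gt_eqF// mulr1 lnK.
have ku' : expR (k%:R * h) <= u by rewrite ku.
have n1 := windows_error H ux h0 ku' e3; rewrite ku divff ?gt_eqF// in n1.
have c1 : rough_sum R (floor_pow y (u - 1)) y @[y --> \oo] --> g (u - 1).
  by apply: H; apply/andP; split; lra.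
have c2 : (y%:R^-1 : R) @[y --> \oo] --> (0 : R).
  by apply: cvgy_inv; exact: cvgr_idn.
have c3 : y%:R^-1 * rough_sum R (floor_pow y (u - 1)) y @[y --> \oo] --> (0 : R).
  by rewrite -[X in _ --> X](mul0r (g (u - 1))); exact: cvgM.
have n3 := cvgr_distC_le _ _ c3 _ e3.
near=> y.
have y1 : (1 < y)%N by near: y; exact: nbhs_infty_gt.
have y0 : (0 < y)%N by apply: ltnW.
have yX : (y <= floor_pow y u)%N.
  by rewrite -{1}(floor_pow1 R y); exact: floor_pow_homo.
have m1 : `|rough_window R (floor_pow y u) y (floor_pow y u) - (g u - g 1)|
    <= h * (g (u - 1) - g (1 - 1)) + e / 3 by near: y; exact: n1.
have m3 : `|y%:R^-1 * rough_sum R (floor_pow y (u - 1)) y - 0| <= e / 3.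
  by near: y; exact: n3.
have g0 : g 0 = 1 by rewrite (buchstab_shift_small hw) ?lexx ?ler01.
have g1 : g 1 = 1 by rewrite (buchstab_shift_small hw) ?lexx ?ler01.
rewrite subrr g0 g1 -/G in m1.
rewrite rough_sum_buchstab ?(leq_trans y0)//.
(* The prime [p = y], which the first window leaves out, is a separate term. *)
rewrite big_mkcond big_ltn ?ltnS// -big_mkcond /=.
rewrite -/(rough_window R (floor_pow y u) y (floor_pow y u)).
set T := (if _ then _ else _).
have T0 : 0 <= T.
  rewrite /T; case: ifP => [_|//]; apply: mulr_ge0; first by rewrite invr_ge0.
  by apply: sumr_ge0 => m _; rewrite invr_ge0.
have T1 : T <= e / 3.
  rewrite /T; case: ifP => _; last exact: ltW.
  move: m3; rewrite subr0 => m3; apply: le_trans m3.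
  apply: le_trans (ler_norm _); rewrite ler_wpM2l ?invr_ge0//.
  apply: rough_sum_homo; rewrite -[X in floor_pow y (X - 1)]divr1.
  by apply: floor_pow_div_le => //; rewrite powRr1.
move: m1; set W := rough_window _ _ _ _; rewrite !ler_norml => /andP[? ?].
by apply/andP; split; lra.
Unshelve. all: by end_near. Qed.

(** Induction on the integer part of [u]; below [u = 1] the only rough number
   involved is 1. *)
Lemma rough_limit (u : R) : 0 <= u ->
  rough_sum R (floor_pow y u) y @[y --> \oo] --> g u.
Proof.
move=> u0; suff H n : cvg_below n.+1%:R.
  by apply: (H (Num.truncn u)); rewrite u0 truncnS_gt.
elim: n => [|n IH] v /andP[v0 vn].
  rewrite (buchstab_shift_small hw) ?v0 ?(ltW vn)//.
  by apply: rough_sum_floor_pow_small; rewrite v0.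
have [v1|v1] := ltP v 1.
  rewrite (buchstab_shift_small hw) ?v0 ?(ltW v1)//.
  by apply: rough_sum_floor_pow_small; rewrite v0.
apply: rough_limit_step IH => //; move: vn; rewrite -(natr1 n.+1); lra.
Qed.

End rough_limit.

(** * The size of the nth prime *)

Lemma nth_prime_next N p : prime p -> (nth_prime N < p)%N ->
  (nth_prime N.+1 <= p)%N.
Proof.
move=> pp Np; rewrite /nth_prime iterS -/(nth_prime N) /next_prime.
by case: ex_minnP => q _; apply; rewrite Np pp.
Qed.

Lemma prime_count_nth_prime (R : realType) N :
  prime_sum (fun=> 1) (nth_prime N) = N%:R :> R.
Proof.
elim: N => [|N IH]; first exact: prime_sum0.
have h := nth_prime_lt N; have pp := nth_primeS_prime N.
rewrite (prime_sum_split _ (ltnW h)) IH -(natr1 N); congr (_ + _).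
rewrite big_mkcond big_nat_recr//= pp big_nat big1 ?add0r// => p /andP[Np pN].
case: ifP => // pp'; have := nth_prime_next pp' Np.
by rewrite leqNgt pN.
Qed.

Lemma cvgn_nth_prime : nth_prime N @[N --> \oo] --> \oo.
Proof. exact: cvg_nat_ge leq_nth_prime. Qed.

(** Let [q = nth_prime N] and [a < 1]. The primes between [q ^ a] and [q] are at
   most [N] in number, but the sum of their reciprocals has the positive limit
   [- ln a]: hence [N] is at least a constant times [q ^ a]. *)
Lemma ln_nth_prime_ratio (R : realType) :
  ln N%:R / ln (nth_prime N)%:R @[N --> \oo] --> (1 : R).
Proof.
apply/cvgrPdist_le => e e0.
pose a : R := (1 + e / 2)^-1.
have e2 : 0 < e / 2 by rewrite divr_gt0.
have a0 : 0 < a by rewrite invr_gt0; lra.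
have a1 : a < 1 by rewrite invf_lt1; lra.
have ae : 1 - a <= e / 2.
  have : a * (1 + e / 2) = 1 by rewrite mulVf//; apply: lt0r_neq0; lra.
  nra.
pose c := - ln a / 2; have c0 : 0 < c.
  by rewrite divr_gt0// oppr_gt0 ln_lt0// a0.
pose M n : R := prime_sum (fun p => p%:R^-1) n.
have W : M (floor_pow (nth_prime N) (1 : R)) - M (floor_pow (nth_prime N) a)
    @[N --> \oo] --> - ln a.
  have := prime_recip_window a0 ltr01; rewrite ln1 sub0r => W.
  pose D q : R := M (floor_pow q (1 : R)) - M (floor_pow q a).
  exact: (@cvg_comp _ _ _ nth_prime D _ _ _ cvgn_nth_prime W).
have cl : c < - ln a by move: c0; rewrite /c; lra.
have nW := cvgr_ge _ W c cl.
have lq : (ln c * (ln (nth_prime N)%:R)^-1 : R) @[N --> \oo] --> (0 : R).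
  rewrite -(mulr0 (ln c)); apply: cvgMr; apply: cvgy_inv.
  exact: (cvg_comp _ _ cvgn_nth_prime (@cvgn_ln_natr R)).
have nlq := cvgr0_norm_le _ lq _ e2.
near=> N.
have N1 : (1 < N)%N by near: N; exact: nbhs_infty_gt.
have Nq : (N <= nth_prime N)%N by exact: leq_nth_prime.
have q0 : (0 < nth_prime N)%N by apply: leq_trans Nq; apply: ltnW.
have lq0 : 0 < ln (nth_prime N)%:R :> R by rewrite ln_natr_gt0// (leq_trans N1).
have h1 : ln N%:R / ln (nth_prime N)%:R <= 1 :> R.
  by rewrite ler_pdivrMr// mul1r ler_ln_natr.
have h2 : c <= M (floor_pow (nth_prime N) (1 : R)) - M (floor_pow (nth_prime N) a).
  by near: N; exact: nW.
have h3 : `|ln c / ln (nth_prime N)%:R| <= e / 2 by near: N; exact: nlq.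
have qa0 : 0 < (nth_prime N)%:R `^ a :> R by rewrite powR_gt0// ltr0n.
have h4 : M (floor_pow (nth_prime N) (1 : R)) - M (floor_pow (nth_prime N) a)
    <= N%:R / (nth_prime N)%:R `^ a.
  have qaq : (floor_pow (nth_prime N) a <= nth_prime N)%N.
    by rewrite -{2}(floor_pow1 R (nth_prime N)) floor_pow_homo// ltW.
  rewrite floor_pow1 /M (prime_sum_split _ qaq) addrAC subrr add0r.
  rewrite -(@prime_count_nth_prime R N) (prime_sum_split _ qaq).
  apply: (@le_trans _ _ (\sum_((floor_pow (nth_prime N) a).+1 <= p <
      (nth_prime N).+1 | prime p) 1 / (nth_prime N)%:R `^ a)).
    rewrite big_nat_cond [leRHS]big_nat_cond.
    apply: ler_sum => p /andP[/andP[ap _] pp].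
    rewrite div1r lef_pV2 ?posrE ?ltr0n ?prime_gt0//.
    by rewrite ltW// ltNge -leq_floor_pow -ltnNge.
  rewrite -mulr_suml ler_wpM2r ?invr_ge0 ?powR_ge0// lerDr.
  by apply: prime_sum_ge0.
have h5 : ln c + a * ln (nth_prime N)%:R <= ln N%:R.
  have N0 : 0 < N%:R :> R by rewrite ltr0n ltnW.
  rewrite -ln_powR -lnM ?posrE// ler_ln ?posrE ?(mulr_gt0 c0 qa0)//.
  by rewrite -ler_pdivlMr// (le_trans h2).
have h6 : ln c / ln (nth_prime N)%:R + a <= ln N%:R / ln (nth_prime N)%:R.
  by rewrite ler_pdivlMr// mulrDl divfK ?gt_eqF.
rewrite ger0_norm ?subr_ge0//; move: h3; rewrite ler_norml => /andP[? ?]; lra.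
Unshelve. all: by end_near. Qed.

Lemma lnln_nth_prime (R : realType) :
  ln (ln (nth_prime N)%:R) - ln (ln N%:R) @[N --> \oo] --> (0 : R).
Proof.
have h := cvg_comp _ _ (@ln_nth_prime_ratio R) (continuous_ln (@ltr01 R)).
rewrite ln1 in h.
have hN : - ln (ln N%:R / ln (nth_prime N)%:R) @[N --> \oo] --> (0 : R).
  by rewrite -[X in _ --> X]oppr0; apply: cvgN; exact: h.
apply: cvg_trans hN.
apply: near_eq_cvg; near=> N.
have N1 : (1 < N)%N by near: N; exact: nbhs_infty_gt.
have Nq := leq_nth_prime N.
by rewrite ln_div ?posrE ?ln_natr_gt0 ?(leq_trans N1)// opprB.
Unshelve. all: by end_near. Qed.

(** * Weighted averages over the primes *)

Lemma cvg_ratio1 (R : realType) (u v : nat -> R) (l : R) :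
  u n - v n @[n --> \oo] --> l -> v n @[n --> \oo] --> +oo ->
  u n / v n @[n --> \oo] --> (1 : R).
Proof.
move=> uv vy; have v0 : (v n)^-1 @[n --> \oo] --> (0 : R) by exact: cvgy_inv.
have nv : \forall n \near \oo, 0 < v n by move/cvgryPgt : vy; exact.
have h : (u n - v n) * (v n)^-1 @[n --> \oo] --> (0 : R).
  by rewrite -[X in _ --> X](mulr0 l); exact: cvgM.
have h1 : 1 + (u n - v n) * (v n)^-1 @[n --> \oo] --> (1 : R).
  by rewrite -[X in _ --> X]addr0; apply: cvgD; [exact: cvg_cst|exact: h].
apply: cvg_trans h1.
apply: near_eq_cvg; near=> n.
have vn : 0 < v n by near: n; exact: nv.
by rewrite mulrBl divff ?gt_eqF// addrC subrK.
Unshelve. all: by end_near. Qed.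

Lemma prime_sum_average0 (R : realType) (f : nat -> R) :
  f n @[n --> \oo] --> (0 : R) ->
  prime_sum (fun p => p%:R^-1 * f p) n / ln (ln n%:R) @[n --> \oo] --> (0 : R).
Proof.
move=> f0; apply/cvgr0Pnorm_le => e e0; have e3 : 0 < e / 3 by rewrite divr_gt0.
have [P _ HP] := cvgr0_norm_le _ f0 _ e3.
have [c Mc] := mertens2 R.
have nM := cvgr_le _ Mc (c + 1) (ltac:(lra)).
pose K := prime_sum (fun p => p%:R^-1 * `|f p|) P + e / 3 * `|c + 1|.
have lly := @cvgn_lnln_natr R.
have nK : \forall n \near \oo, K / (e / 3) <= ln (ln n%:R).
  by move/cvgryPge : lly; exact.
have n0 : \forall n \near \oo, 0 < ln (ln n%:R) :> R.
  by move/cvgryPgt : lly; exact.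
near=> n.
have Pn : (P <= n)%N by near: n; exact: nbhs_infty_ge.
have l0 : 0 < ln (ln n%:R) :> R by near: n; exact: n0.
have hK : K <= e / 3 * ln (ln n%:R).
  rewrite mulrC -ler_pdivrMr//; near: n; exact: nK.
have hM : prime_sum (fun p => p%:R^-1) n - ln (ln n%:R) <= c + 1.
  by near: n; exact: nM.
rewrite normrM [`|_^-1|]ger0_norm ?invr_ge0 ?(ltW l0)// ler_pdivrMr//.
rewrite (prime_sum_split _ Pn); apply: le_trans (ler_normD _ _) _.
have b1 : `|prime_sum (fun p => p%:R^-1 * f p) P| <=
    prime_sum (fun p => p%:R^-1 * `|f p|) P.
  apply: le_trans (ler_norm_sum _ _ _) _; apply: ler_sum => p _.
  by rewrite normrM ger0_norm ?invr_ge0.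
have b2 : `|\sum_(P.+1 <= p < n.+1 | prime p) p%:R^-1 * f p| <=
    e / 3 * prime_sum (fun p => p%:R^-1) n.
  apply: le_trans (ler_norm_sum _ _ _) _.
  rewrite (prime_sum_split _ Pn) mulrDr; apply: ler_wpDl.
    by rewrite mulr_ge0 ?(ltW e3)// prime_sum_ge0// => p _; rewrite invr_ge0.
  rewrite mulr_sumr big_nat_cond [leRHS]big_nat_cond.
  apply: ler_sum => p /andP[/andP[Pp _] _].
  rewrite normrM ger0_norm ?invr_ge0// mulrC ler_wpM2r ?invr_ge0//.
  by apply: HP => /=; exact: ltnW.
have b3 : e / 3 * prime_sum (fun p => p%:R^-1) n <=
    e / 3 * (`|c + 1| + ln (ln n%:R)).
  by rewrite ler_wpM2l ?(ltW e3)//; have := ler_norm (c + 1); lra.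
have el : 0 <= e * ln (ln n%:R) by rewrite mulr_ge0 ?(ltW e0) ?(ltW l0).
move: hK; rewrite /K; rewrite mulrDr in b3; lra.
Unshelve. all: by end_near. Qed.

(** A weighted Cesaro mean: [1 / p] has total weight [ln (ln n) + O(1)]. *)
Lemma prime_sum_average (R : realType) (f : nat -> R) (l : R) :
  f n @[n --> \oo] --> l ->
  prime_sum (fun p => p%:R^-1 * f p) n / ln (ln n%:R) @[n --> \oo] --> l.
Proof.
move=> fl; have [c Mc] := mertens2 R.
have M1 := cvg_ratio1 Mc (@cvgn_lnln_natr R).
have h : f n - l @[n --> \oo] --> (0 : R).
  by rewrite -[X in _ --> X](subrr l); apply: cvgB => //; exact: cvg_cst.
have h0 := prime_sum_average0 h.
rewrite (_ : (fun n => _) = fun n => prime_sum (fun p => p%:R^-1 * (f p - l)) n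
   / ln (ln n%:R) + l * (prime_sum (fun p => p%:R^-1) n / ln (ln n%:R))); last first.
  apply/funext => n; rewrite mulrA -mulrDl -prime_sumZ -prime_sumD.
  by congr (_ / _); apply: eq_prime_sum => p _; ring.
rewrite -[X in _ --> X]add0r -[X in _ --> _ + X]mulr1.
by apply: cvgD => //; exact: cvgMr.
Qed.

(** * The event *)

Lemma log_ratio_leE (R : realType) (s : R) n : 1 <= s -> (1 < n)%N ->
  (log_ratio R n <= s) = (n <= floor_pow (pdiv n) s)%N.
Proof.
move=> s1 n1; have p1 : (1 < pdiv n)%N by rewrite prime_gt1// pdiv_prime.
have l0 := @ln_natr_gt0 R _ p1.
rewrite /log_ratio ler_pdivrMr// leq_floor_pow powR_natrE ?(ltnW p1)//.
by rewrite -[in RHS](lnK (x := n%:R)) ?posrE ?ltr0n ?(ltnW n1)// ler_expR.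
Qed.

Lemma root_le_pdivE (R : realType) (s : R) n : 1 <= s -> (0 < n)%N ->
  (n%:R `^ (1 / s) <= (pdiv n)%:R :> R) = (log_ratio R n <= s).
Proof.
move=> s1 n0; have s0 : 0 < s by lra.
have [->|n1] := eqVneq n 1%N.
  by rewrite log_ratio1 powR1 lexx (ltW s0).
have {}n1 : (1 < n)%N by rewrite ltn_neqAle eq_sym n1.
have p1 : (1 < pdiv n)%N by rewrite prime_gt1// pdiv_prime.
have l0 := @ln_natr_gt0 R _ p1.
rewrite /log_ratio ler_pdivrMr// powR_natrE//.
rewrite -[X in _ <= X = _](lnK (x := (pdiv n)%:R)) ?posrE ?ltr0n ?(ltnW p1)//.
by rewrite ler_expR mulrC mul1r ler_pdivrMr// mulrC.
Qed.

Lemma floor_pow_div (R : realType) p (s : R) : (0 < p)%N -> 0 < s ->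
  (floor_pow p s %/ p)%N = floor_pow p (s - 1).
Proof.
move=> p0 s0; apply/eqP; rewrite eqn_leq -[X in floor_pow p (X - 1)]divr1.
by rewrite floor_pow_div_le ?floor_pow_div_ge ?powRr1.
Qed.

Definition small_ratio_sum (R : realType) (s : R) (n : nat) : R :=
  prime_sum (fun p => p%:R^-1 * rough_sum R (floor_pow p (s - 1)) p) n.

(** A number of least prime factor [p] is [p * m] with [m] [p]-rough, and it is at
   most [p ^ s] when [m] is at most [p ^ (s - 1)]. The bound [X] only serves to
   make the range of the sum independent of [p]. *)
Lemma small_ratio_sumE (R : realType) (s : R) n X : 0 < s ->
  (floor_pow n s <= X)%N -> small_ratio_sum s n =
  \sum_(2 <= k < X.+1 | (pdiv k <= n)%N && (k <= floor_pow (pdiv k) s)%N) k%:R^-1.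
Proof.
move=> s0 nX; rewrite /small_ratio_sum /prime_sum.
transitivity (\sum_(2 <= k < X.+1) \sum_(0 <= p < n.+1 |
    prime p && ((pdiv k == p) && (k <= floor_pow p s)%N)) k%:R^-1 : R).
  rewrite (exchange_big_dep prime)/=; last by move=> i j _ /andP[].
  rewrite big_nat_cond [RHS]big_nat_cond.
  apply: eq_bigr => p /andP[/andP[_ pn] pp]; have p0 := prime_gt0 pp.
  rewrite -floor_pow_div// -sum_pdiv_eq//.
  have pX : (floor_pow p s <= X)%N.
    apply: leq_trans nX; apply: le_truncn; apply: ge0_ler_powR.
    - exact: ltW.
    - by rewrite nnegrE.
    - by rewrite nnegrE.
    - by rewrite ler_nat -ltnS.
  have [X1|X1] := ltnP (floor_pow p s) 2.
    rewrite [LHS]big_geq//= big_nat_cond big1// => k /andP[/andP[k2 _] /and3P[_ _ kp]].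
    by have := leq_ltn_trans kp X1; rewrite ltnNge k2.
  rewrite [RHS](big_cat_nat (n := (floor_pow p s).+1))//=; last exact: leqW.
  rewrite [X in _ + X]big_nat_cond [X in _ + X]big1 ?addr0; last first.
    by move=> k /andP[/andP[pk _] /and3P[_ _]]; rewrite leqNgt pk.
  rewrite big_nat_cond [RHS]big_nat_cond; apply: eq_bigl => k.
  by rewrite pp ltnS; case: (k <= _)%N; rewrite ?andbF// !andbT.
rewrite [RHS]big_mkcond [LHS]big_nat [RHS]big_nat; apply: eq_bigr => k /andP[k2 _].
have pk : prime (pdiv k) by exact: pdiv_prime.
case: ifPn => [/andP[kn ks]|H].
  rewrite (big_cat_nat (n := pdiv k))//= ?(leqW kn)//.
  rewrite big_nat_cond big1 ?add0r; last first.
    by move=> p /andP[/andP[_ h] /and3P[_ /eqP E _]]; rewrite E ltnn in h.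
  rewrite big_mkcond big_ltn// pk eqxx ks /= big_nat_cond big1 ?addr0// => p.
  move=> /andP[/andP[h _] _]; case: ifP => // /and3P[_ /eqP E _].
  by rewrite E ltnn in h.
rewrite big_nat_cond big1// => p /andP[/andP[_ pn] /and3P[_ /eqP E kp]].
by move: H; rewrite E kp -ltnS pn.
Qed.

Lemma small_ratio_sum_cvg (R : realType) (w : R -> R) (s : R) :
  is_buchstab w -> 1 <= s ->
  small_ratio_sum s n / ln (ln n%:R) @[n --> \oo] --> s * w s.
Proof.
move=> hw s1; have -> : s * w s = buchstab_shift w (s - 1).
  by rewrite /buchstab_shift subrK.
by apply: prime_sum_average; apply: rough_limit => //; rewrite subr_ge0.
Qed.

(** The number 1 is in the range of all the sums that converge to [s * w s]; in
   particular this limit is not 0. *)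
Lemma buchstab_ge1 (R : realType) (w : R -> R) (s : R) :
  is_buchstab w -> 1 <= s -> 1 <= s * w s.
Proof.
move=> hw s1; have -> : s * w s = buchstab_shift w (s - 1).
  by rewrite /buchstab_shift subrK.
have s0 : 0 <= s - 1 by rewrite subr_ge0.
apply: cvgr_to_ge (rough_limit hw s0) _; near=> y.
apply: rough_sum_ge1; rewrite leq_floor_pow powR_natrE.
  by apply: le_trans (expR_ge1Dx _); rewrite lerDl mulr_ge0// ln_natr_ge0.
near: y; exact: nbhs_infty_gt.
Unshelve. all: by end_near. Qed.

Section event.
Variables (R : realType) (s : R) (N : nat).
Hypotheses (s1 : 1 <= s) (N0 : (0 < N)%N).

Let E : set nat := [set n | Omega N n /\ log_ratio R n <= s].
Let q := nth_prime N.
Let X := floor_pow q s.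

Let s0 : 0 < s. Proof. exact: lt_le_trans s1. Qed.

Let q0 : (0 < q)%N.
Proof. exact: leq_trans N0 (leq_nth_prime N). Qed.

Let E_bounded k : E k -> (k < X.+1)%N.
Proof.
move=> [Ok rk]; rewrite ltnS; have [k0 _] := Ok.
have [->|k1] := eqVneq k 1%N.
  rewrite leq_floor_pow powR_natrE//; apply: le_trans (expR_ge1Dx _).
  by rewrite lerDl mulr_ge0 ?(ltW s0)// ln_natr_ge0.
have {}k1 : (1 < k)%N by rewrite ltn_neqAle eq_sym k1.
move: rk; rewrite log_ratio_leE// => /leq_trans; apply.
apply: le_truncn; apply: ge0_ler_powR; rewrite ?nnegrE ?(ltW s0)// ler_nat.
by move: Ok; rewrite Omega_smooth => -[_]; apply; rewrite ?pdiv_prime ?pdiv_dvd.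
Qed.

Let T : R := \sum_(0 <= k < X.+1 | k \in E) k%:R^-1.

Let fine_PE : fine (P N E : \bar R) = (C N)^-1 * T.
Proof.
have EO : E `&` Omega N = E.
  by apply/seteqP; split=> [k []//|k Ek]; split => //; case: Ek.
rewrite /P EO esum_natZl ?invr_ge0 ?(ltW (C_gt0 _ _))//.
by rewrite (@esum_nat_bounded _ _ _ _ X.+1).
Qed.

(* The smoothness condition is void for the numbers of the event whose least
   prime factor [p] is at most [q ^ (1 / s)]: they are at most [p ^ s <= q]. The
   isolated 1 is the contribution of the number 1. *)
Let T_bounds : small_ratio_sum s (floor_pow q (1 / s)) <= T
    <= 1 + small_ratio_sum s q.
Proof.
have X0 : (0 < X)%N.
  apply: (@E_bounded 1); split; first exact: Omega1.
  by rewrite log_ratio1 ltW.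
have zq : (floor_pow q (1 / s) <= q)%N.
  rewrite -{2}(floor_pow1 R q); apply: floor_pow_homo => //.
  by rewrite ler_pdivrMr// mul1r.
have zX : (floor_pow (floor_pow q (1 / s)) s <= X)%N.
  apply: le_truncn; apply: ge0_ler_powR; rewrite ?nnegrE ?(ltW s0)// ler_nat//.
have T0 : \sum_(0 <= k < 2 | k \in E) k%:R^-1 = 1 :> R.
  rewrite big_mkcond big_ltn// big_ltn// big_geq//= invr0 if_same add0r addr0 invr1.
  by rewrite mem_set//; split; [exact: Omega1|rewrite log_ratio1 ltW].
rewrite (small_ratio_sumE s0 zX) (@small_ratio_sumE _ _ q X)//.
rewrite /T (big_cat_nat (m := 0) (n := 2))//= T0.
apply/andP; split.
  rewrite -[leLHS]add0r lerD// big_mkcond [leRHS]big_mkcond /=.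
  rewrite big_nat [leRHS]big_nat; apply: ler_sum => k /andP[k1 kX].
  case: ifP => [/andP[pz kp]|_]; last by case: ifP => _; rewrite ?invr_ge0.
  rewrite mem_set//; split; last by rewrite log_ratio_leE.
  rewrite Omega_smooth; split; first exact: ltnW.
  move=> p pp pk; apply: leq_trans (dvdn_leq (ltnW k1) pk) _.
  apply: leq_trans kp _; rewrite -(@ler_nat R).
  apply: (@le_trans _ _ ((pdiv k)%:R `^ s)); first by rewrite -leq_floor_pow.
  apply: (@le_trans _ _ ((q%:R `^ (1 / s)) `^ s)).
    apply: ge0_ler_powR; rewrite ?nnegrE ?powR_ge0 ?(ltW s0)//.
    by rewrite -leq_floor_pow.
  by rewrite -powRrM divfK ?gt_eqF// powRr1.
rewrite lerD2l big_mkcond [leRHS]big_mkcond /= big_nat [leRHS]big_nat.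
apply: ler_sum => k /andP[k1 kX].
case: ifPn => [|_]; last by case: ifP => _; rewrite ?invr_ge0.
rewrite inE => -[Ok rk]; rewrite ifT//; move: rk; rewrite log_ratio_leE// => ->.
rewrite andbT; move: Ok; rewrite Omega_smooth => -[_]; apply.
  by rewrite pdiv_prime.
exact: pdiv_dvd.
Qed.

Lemma P_small_ratio_bounds :
  (C N)^-1 * small_ratio_sum s (floor_pow (nth_prime N) (1 / s)) <=
    fine (P N [set n | Omega N n /\ log_ratio R n <= s] : \bar R) <=
  (C N)^-1 * (1 + small_ratio_sum s (nth_prime N)).
Proof.
have C0 : 0 <= (C N : R)^-1 by rewrite invr_ge0 ltW ?C_gt0.
case/andP: T_bounds => T1 T2.
by rewrite -/E fine_PE !ler_wpM2l.
Qed.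

End event.

(** Mertens' third theorem at the [N]th prime [q], where [ln (ln q)] may be
   replaced by [ln (ln N)]. *)
Lemma C_asymptotic (R : realType) :
  expR (euler_gamma R) * ln N%:R / C N @[N --> \oo] --> (1 : R).
Proof.
have h : euler_gamma R + ln (ln N%:R) - ln (C N) @[N --> \oo] --> (0 : R).
  rewrite (_ : (fun N => _) = fun N => euler_gamma R
     - (log_euler R (nth_prime N) - ln (ln (nth_prime N)%:R))
     - (ln (ln (nth_prime N)%:R) - ln (ln N%:R))); last first.
    by apply/funext => N; rewrite C_prime_sum /log_euler; ring.
  rewrite -[X in _ --> X](subrr (0 : R)); apply: cvgB; last exact: lnln_nth_prime.
  rewrite -[X in _ --> X](subrr (euler_gamma R)); apply: cvgB; first exact: cvg_cst.
  exact: (cvg_comp _ _ cvgn_nth_prime (@mertens3 R)).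
have := cvg_comp _ _ h (@continuous_expR R 0); rewrite expR0.
apply: cvg_trans; apply: near_eq_cvg; near=> N => /=.
have l0 : 0 < ln N%:R :> R by rewrite ln_natr_gt0//; near: N; exact: nbhs_infty_gt.
by rewrite expRB expRD !lnK ?posrE// C_gt0.
Unshelve. all: by end_near. Qed.

Theorem theorem3 (R : realType) (w : R -> R) (hw : is_buchstab w)
    (s : R) (hs : 1 <= s) :
  (forall N : nat,
     P N [set n : nat | Omega N n /\ n%:R `^ (1 / s) <= (pdiv n)%:R :> R]
     = P N [set n : nat | Omega N n /\ log_ratio R n <= s] :> \bar R) /\
  asymp_equiv
    (fun N : nat =>
       fine (P N [set n : nat | Omega N n /\ log_ratio R n <= s] : \bar R))
    (fun N : nat =>
       expR (- euler_gamma R) * ln (ln N%:R) * ((s * w s) / ln N%:R)).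
Proof.
split.
  move=> N; congr (P N _); apply/seteqP; split=> n [On].
    by case: (On) => n0 _; rewrite root_le_pdivE.
  by case: (On) => n0 _; rewrite -root_le_pdivE.
have s0 : 0 < s by lra.
have L1 := buchstab_ge1 hw hs; set L := s * w s in L1 *.
have L0 : 0 < L by lra.
have Qc := small_ratio_sum_cvg hw hs; rewrite -/L in Qc.
have lly := @cvgn_lnln_natr R.
have q1 : ln (ln (nth_prime N)%:R) / ln (ln N%:R) @[N --> \oo] --> (1 : R).
  exact: cvg_ratio1 (@lnln_nth_prime R) lly.
have qQ : small_ratio_sum s (nth_prime N) / ln (ln (nth_prime N)%:R)
    @[N --> \oo] --> L by exact: (cvg_comp _ _ cvgn_nth_prime Qc).
have si : 0 < 1 / s by rewrite divr_gt0.
pose z N := floor_pow (nth_prime N) (1 / s).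
have zoo : z N @[N --> \oo] --> \oo.
  exact: (cvg_comp _ _ cvgn_nth_prime (cvgn_floor_pow si)).
have zQ : small_ratio_sum s (z N) / ln (ln (z N)%:R) @[N --> \oo] --> L.
  exact: (cvg_comp _ _ zoo Qc).
have z1 : ln (ln (z N)%:R) / ln (ln N%:R) @[N --> \oo] --> (1 : R).
  apply: (@cvg_ratio1 _ _ _ (ln (1 / s) + 0)) => //.
  rewrite (_ : (fun N => _) = fun N =>
    (ln (ln (z N)%:R) - ln (ln (nth_prime N)%:R)) +
    (ln (ln (nth_prime N)%:R) - ln (ln N%:R))); last by apply/funext => N; ring.
  apply: cvgD; last exact: lnln_nth_prime.
  exact: (cvg_comp _ _ cvgn_nth_prime (lnln_floor_pow si)).
have n0 : \forall n \near \oo, 0 < ln (ln n%:R) :> R.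
  by move/cvgryPgt : lly; exact.
have lower : L^-1 * (small_ratio_sum s (z N) / ln (ln N%:R)) *
    (expR (euler_gamma R) * ln N%:R / C N) @[N --> \oo] --> (1 : R).
  rewrite -[X in _ --> X]mulr1; apply: cvgM; last exact: C_asymptotic.
  rewrite -[X in _ --> X](mulVf (lt0r_neq0 L0)); apply: cvgMr.
  rewrite -[X in _ --> X]mulr1.
  have : small_ratio_sum s (z N) / ln (ln (z N)%:R) *
    (ln (ln (z N)%:R) / ln (ln N%:R)) @[N --> \oo] --> L * 1 by exact: cvgM.
  apply: cvg_trans; apply: near_eq_cvg; near=> N.
  have h : 0 < ln (ln (z N)%:R) :> R.
    by near: N; exact: zoo n0.
  by rewrite mulrA divfK ?gt_eqF.
have upper : L^-1 * ((1 + small_ratio_sum s (nth_prime N)) / ln (ln N%:R)) *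
    (expR (euler_gamma R) * ln N%:R / C N) @[N --> \oo] --> (1 : R).
  rewrite -[X in _ --> X]mulr1; apply: cvgM; last exact: C_asymptotic.
  rewrite -[X in _ --> X](mulVf (lt0r_neq0 L0)); apply: cvgMr.
  have : (ln (ln N%:R))^-1 + small_ratio_sum s (nth_prime N) / ln (ln (nth_prime N)%:R) *
    (ln (ln (nth_prime N)%:R) / ln (ln N%:R)) @[N --> \oo] --> 0 + L * 1.
    by apply: cvgD; [exact: cvgy_inv|exact: cvgM].
  rewrite add0r mulr1; apply: cvg_trans; apply: near_eq_cvg; near=> N.
  have h : 0 < ln (ln (nth_prime N)%:R) :> R.
    by near: N; exact: cvgn_nth_prime n0.
  by rewrite mulrA divfK ?gt_eqF// mulrDl mul1r.
rewrite /asymp_equiv; apply: squeeze_cvgr lower upper; near=> N.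
have N1 : (1 < N)%N by near: N; exact: nbhs_infty_gt.
have llN : 0 < ln (ln N%:R) :> R by near: N; exact: n0.
have lN : 0 < ln N%:R :> R by rewrite ln_natr_gt0.
have CN : 0 < C N :> R by exact: C_gt0.
have eg : 0 < expR (euler_gamma R) by exact: expR_gt0.
have := @P_small_ratio_bounds R s N hs (ltnW N1).
rewrite -/(z N); set F := fine _; rewrite expRN.
set lo := small_ratio_sum _ _; set up := 1 + small_ratio_sum _ _ => /andP[F1 F2].
set D := _ * _ * (L / _).
have D0 : 0 < D.
  by rewrite mulr_gt0 ?divr_gt0// mulr_gt0 ?invr_gt0.
have DE (x : R) : L^-1 * (x / ln (ln N%:R)) * (expR (euler_gamma R) * ln N%:R / C N)
    = (C N)^-1 * x / D.
  by rewrite /D; field; rewrite !gt_eqF.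
by rewrite !DE !ler_pM2r ?invr_gt0// F1.
Unshelve. all: by end_near. Qed.
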